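(* Let $\Omega\subseteq\mathbb{H}$ be a domain and let $f:\Omega\to\mathbb{H}$ be a function. Then $f$ is slice regular in $\Omega$ if, and only if, $f$ is $\sigma$-analytic in $\Omega$.
   Context: $\mathbb{H}$ is the skew field of real quaternions, with real part $Re(q)$, imaginary part $Im(q)$ and Euclidean modulus $|q|$. A domain is a nonempty connected open subset for the Euclidean topology. Let $\mathbb{S}=\{q\in\mathbb{H}:q^2=-1\}$ and, for $I\in\mathbb{S}$, $L_I=\mathbb{R}+I\mathbb{R}$ (a ''complex line''). Slice regularity: for $I\in\mathbb{S}$ put $\Omega_I=\Omega\cap L_I$ and $f_I=f|_{\Omega_I}$. The function $f$ is slice regular if for every $I\in\mathbb{S}$ the restriction $f_I$ is holomorphic, i.e. it is real differentiable on $\Omega_I$ and $\frac12\left(\frac{\partial}{\partial x}+I\frac{\partial}{\partial y}\right)f_I(x+Iy)=0$ for all $x+Iy\in\Omega_I$. Distance $\sigma$: for $p,q\in\mathbb{H}$ put $\omega(q,p)=\sqrt{[Re(q)-Re(p)]^2+[|Im(q)|+|Im(p)|]^2}$, and let $\sigma(q,p)=|q-p|$ if $p,q$ lie in a common complex line $L_I$, and $\sigma(q,p)=\omega(q,p)$ otherwise. The map $\sigma$ is a distance on $\mathbb{H}$ whose topology is finer than the Euclidean one. The regular multiplication $*$ of polynomials/power series with right coefficients is $\left(\sum_n q^n a_n\right)*\left(\sum_n q^n b_n\right)=\sum_n q^n\sum_{k=0}^n a_kb_{n-k}$, and $(q-p)^{*n}$ is the $n$-th power of $q-p$ with respect to $*$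 (with $(q-p)^{*0}=1$). $\sigma$-analyticity: $f$ is $\sigma$-analytic at $p\in\Omega$ if there exist a neighborhood $U$ of $p$ in $\Omega$ for the topology of $\sigma$ and a series $\sum_n(q-p)^{*n}b_n$ ($b_n\in\mathbb{H}$), converging in $U$ (with respect to the Euclidean norm), such that $f(q)=\sum_n(q-p)^{*n}b_n$ for all $q\in U$; $f$ is $\sigma$-analytic if it is so at all $p\in\Omega$. *)

(* Defs.v *)
From HB Require Import structures.
From mathcomp Require Import all_boot all_order all_algebra.
From mathcomp Require Import boolp classical_sets reals topology normedtype.
From mathcomp Require Import sequences derive.
From mathcomp Require Import ring lra.
Import numFieldNormedType.Exports.

Set Implicit Arguments.
Unset Strict Implicit.
Unset Printing Implicit Defensive.

Import Order.TTheory GRing.Theory Num.Theory.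

Local Open Scope classical_set_scope.
Local Open Scope ring_scope.

(* [Quat a b c d] is a + b i + c j + d k. *)
Record quaternion (R : realType) := Quat { qre : R; qi : R; qj : R; qk : R }.

Section Algebra.
Variable R : realType.
Local Notation H := (quaternion R).
Implicit Types p q r : H.

Let to_tuple q := (qre q, qi q, qj q, qk q).
Let of_tuple (t : R * R * R * R) := Quat t.1.1.1 t.1.1.2 t.1.2 t.2.
Let to_tupleK : cancel to_tuple of_tuple. Proof. by case. Qed.

HB.instance Definition _ := Choice.copy H (can_type to_tupleK).

Lemma quat_ext p q :
  qre p = qre q -> qi p = qi q -> qj p = qj q -> qk p = qk q -> p = q.
Proof. by case: p q => [????] [????] /= -> -> -> ->. Qed.

Definition quat_add p q :=
  Quat (qre p + qre q) (qi p + qi q) (qj p + qj q) (qk p + qk q).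
Definition quat_opp q := Quat (- qre q) (- qi q) (- qj q) (- qk q).
Definition quat_mul p q :=
  Quat (qre p * qre q - qi p * qi q - qj p * qj q - qk p * qk q)
       (qre p * qi q + qi p * qre q + qj p * qk q - qk p * qj q)
       (qre p * qj q - qi p * qk q + qj p * qre q + qk p * qi q)
       (qre p * qk q + qi p * qj q - qj p * qi q + qk p * qre q).
Definition quat_scale (a : R) q :=
  Quat (a * qre q) (a * qi q) (a * qj q) (a * qk q).

Let addqA : associative quat_add.
Proof. by move=> p q r; apply: quat_ext => /=; ring. Qed.
Let addqC : commutative quat_add.
Proof. by move=> p q; apply: quat_ext => /=; ring. Qed.
Let add0q : left_id (Quat 0 0 0 0) quat_add.
Proof. by move=> q; apply: quat_ext => /=; ring. Qed.
Let addNq : left_inverse (Quat 0 0 0 0) quat_opp quat_add.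
Proof. by move=> q; apply: quat_ext => /=; ring. Qed.

HB.instance Definition _ := GRing.isZmodule.Build H addqA addqC add0q addNq.

Let mulqA : associative quat_mul.
Proof. by move=> p q r; apply: quat_ext => /=; ring. Qed.
Let mul1q : left_id (Quat 1 0 0 0) quat_mul.
Proof. by move=> q; apply: quat_ext => /=; ring. Qed.
Let mulq1 : right_id (Quat 1 0 0 0) quat_mul.
Proof. by move=> q; apply: quat_ext => /=; ring. Qed.
Let mulqDl : left_distributive quat_mul quat_add.
Proof. by move=> p q r; apply: quat_ext => /=; ring. Qed.
Let mulqDr : right_distributive quat_mul quat_add.
Proof. by move=> p q r; apply: quat_ext => /=; ring. Qed.
Let oneq_neq0 : Quat 1 0 0 0 != 0 :> H.
Proof. by apply/eqP => -[] /eqP; rewrite oner_eq0. Qed.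

HB.instance Definition _ :=
  GRing.Zmodule_isNzRing.Build H mulqA mul1q mulq1 mulqDl mulqDr oneq_neq0.

Let scaleqA a b q : quat_scale a (quat_scale b q) = quat_scale (a * b) q.
Proof. by apply: quat_ext => /=; ring. Qed.
Let scale1q : left_id 1 quat_scale.
Proof. by move=> q; apply: quat_ext => /=; ring. Qed.
Let scaleqDr : right_distributive quat_scale +%R.
Proof. by move=> a p q; apply: quat_ext => /=; ring. Qed.
Let scaleqDl q : {morph quat_scale^~ q : a b / a + b}.
Proof. by move=> a b; apply: quat_ext => /=; ring. Qed.

HB.instance Definition _ :=
  GRing.Zmodule_isLmodule.Build R H scaleqA scale1q scaleqDr scaleqDl.

Let scaleqAl a p q : a *: (p * q) = a *: p * q.
Proof. by apply: quat_ext => /=; ring. Qed.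
Let scaleqAr a p q : a *: (p * q) = p * (a *: q).
Proof. by apply: quat_ext => /=; ring. Qed.

HB.instance Definition _ := GRing.Lmodule_isLalgebra.Build R H scaleqAl.
HB.instance Definition _ := GRing.Lalgebra_isAlgebra.Build R H scaleqAr.

Lemma qreD p q : qre (p + q) = qre p + qre q. Proof. by []. Qed.
Lemma qiD p q : qi (p + q) = qi p + qi q. Proof. by []. Qed.
Lemma qjD p q : qj (p + q) = qj p + qj q. Proof. by []. Qed.
Lemma qkD p q : qk (p + q) = qk p + qk q. Proof. by []. Qed.
Lemma qreN q : qre (- q) = - qre q. Proof. by []. Qed.
Lemma qiN q : qi (- q) = - qi q. Proof. by []. Qed.
Lemma qjN q : qj (- q) = - qj q. Proof. by []. Qed.
Lemma qkN q : qk (- q) = - qk q. Proof. by []. Qed.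
Lemma qreZ a q : qre (a *: q) = a * qre q. Proof. by []. Qed.
Lemma qiZ a q : qi (a *: q) = a * qi q. Proof. by []. Qed.
Lemma qjZ a q : qj (a *: q) = a * qj q. Proof. by []. Qed.
Lemma qkZ a q : qk (a *: q) = a * qk q. Proof. by []. Qed.
Definition quatE := (qreD, qiD, qjD, qkD, qreN, qiN, qjN, qkN,
                     qreZ, qiZ, qjZ, qkZ).

Definition quat_norm2 q := qre q ^+ 2 + qi q ^+ 2 + qj q ^+ 2 + qk q ^+ 2.
Definition quat_norm q := Num.sqrt (quat_norm2 q).

Lemma quat_norm2_ge0 q : 0 <= quat_norm2 q.
Proof. by rewrite /quat_norm2 !addr_ge0 ?sqr_ge0. Qed.

Let ler_normqD p q : quat_norm (p + q) <= quat_norm p + quat_norm q.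
Proof.
have np : 0 <= quat_norm p by exact: sqrtr_ge0.
have nq : 0 <= quat_norm q by exact: sqrtr_ge0.
rewrite -(@ler_pXn2r _ 2) ?nnegrE ?addr_ge0 ?sqrtr_ge0//.
rewrite sqrrD !sqr_sqrtr ?quat_norm2_ge0//.
set s := qre p * qre q + qi p * qi q + qj p * qj q + qk p * qk q.
suff : s <= quat_norm p * quat_norm q by rewrite /quat_norm2 !quatE /s; lra.
rewrite -sqrtrM ?quat_norm2_ge0// (le_trans (ler_norm s))// -sqrtr_sqr ler_sqrt.
  rewrite -subr_ge0.
  have -> : quat_norm2 p * quat_norm2 q - s ^+ 2 =
      (qre p * qi q - qi p * qre q) ^+ 2 + (qre p * qj q - qj p * qre q) ^+ 2
    + (qre p * qk q - qk p * qre q) ^+ 2 + (qi p * qj q - qj p * qi q) ^+ 2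
    + (qi p * qk q - qk p * qi q) ^+ 2 + (qj p * qk q - qk p * qj q) ^+ 2.
    by rewrite /quat_norm2 /s; ring.
  by rewrite !addr_ge0 ?sqr_ge0.
by rewrite mulr_ge0 ?quat_norm2_ge0.
Qed.

Let normqZ a q : quat_norm (a *: q) = `|a| * quat_norm q.
Proof.
rewrite -sqrtr_sqr -sqrtrM ?sqr_ge0//; congr Num.sqrt.
by rewrite /quat_norm2 !quatE; ring.
Qed.

Let normq0_eq0 q : quat_norm q = 0 -> q = 0.
Proof.
move/eqP; rewrite sqrtr_eq0 => q0.
have {q0} /eqP : quat_norm2 q = 0 by apply/eqP; rewrite eq_le q0 quat_norm2_ge0.
rewrite !paddr_eq0 ?addr_ge0 ?sqr_ge0// !sqrf_eq0.
by move=> /andP[/andP[/andP[/eqP ? /eqP ?] /eqP ?] /eqP ?]; apply: quat_ext.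
Qed.

(* This also makes the topology of [quaternion R] the Euclidean one. *)
HB.instance Definition _ :=
  Lmodule_isNormed.Build R H ler_normqD normqZ normq0_eq0.

Lemma quat_normE q : `|q| = quat_norm q. Proof. by []. Qed.

End Algebra.

Definition qim (R : realType) (q : quaternion R) : quaternion R :=
  Quat 0 (qi q) (qj q) (qk q).

Section Slices.
Variable R : realType.
Local Notation H := (quaternion R).

Definition imag_units : set H := [set I | I ^+ 2 = -1].

Definition slice_pt (I : H) (z : R * R) : H := z.1%:A + z.2 *: I.

Definition complex_line (I : H) : set H := range (slice_pt I).

Definition quat_domain (Omega : set H) :=
  [/\ Omega !=set0, connected Omega & open Omega].

(* Functions on Omega are represented by total functions. Differentiability
   and partial derivatives at z only depend on the values near z, and the
   points z with [slice_pt I z \in Omega] form an open set when Omega is open,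
   so the values of f outside Omega are irrelevant. *)
Definition slice_holomorphic (Omega : set H) (I : H) (f : H -> H) :=
  let fI : R * R -> H := f \o slice_pt I in
  forall z : R * R, Omega (slice_pt I z) ->
    differentiable fI z /\
    2^-1 *: ('D_(1, 0) fI z + I * 'D_(0, 1) fI z) = 0.

Definition slice_regular (Omega : set H) (f : H -> H) :=
  forall I, imag_units I -> slice_holomorphic Omega I f.

End Slices.

Section Sigma.
Variable R : realType.
Local Notation H := (quaternion R).
Implicit Types p q r : H.

Definition same_line q p :=
  exists I, [/\ imag_units I, complex_line I q & complex_line I p].

Definition omega_dist q p : R :=
  Num.sqrt ((qre q - qre p) ^+ 2 + (`|qim q| + `|qim p|) ^+ 2).

Definition sigma_dist q p : R :=
  if `[< same_line q p >] then `|q - p| else omega_dist q p.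

Lemma imag_unitsP (I : H) : imag_units I <-> qre I = 0 /\ `|I| = 1.
Proof.
rewrite quat_normE /quat_norm /imag_units /= expr2; split.
  move: I => [a b c d]; rewrite /quat_norm2 /= => -[e0 e1 e2 e3].
  have a0 : a = 0.
    apply/eqP/negP => /negP a0.
    have f x : a * x + x * a = 0 -> x = 0.
      rewrite (mulrC x) -mulr2n => /eqP.
      by rewrite mulrn_eq0 /= mulf_eq0 (negbTE a0) => /eqP.
    have b0 : b = 0 by apply: f; lra.
    have c0 : c = 0 by apply: f; lra.
    have d0 : d = 0 by apply: f; lra.
    by subst; have := sqr_ge0 a; rewrite expr2; lra.
  split => //; rewrite (_ : _ + _ = 1) ?sqrtr1//.
  by subst a; rewrite !expr2; lra.
move=> [a0 n1]; have : quat_norm2 I = 1.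
  by rewrite -(sqr_sqrtr (quat_norm2_ge0 I)) n1 expr1n.
move: I a0 {n1} => [a b c d] /= ->; rewrite /quat_norm2 /= !expr2 => e.
by apply: quat_ext; rewrite /= ?oppr0; lra.
Qed.

Lemma quat_re_im q : q = (qre q)%:A + qim q.
Proof. by apply: quat_ext => /=; ring. Qed.

Lemma sqr_normq q : `|q| ^+ 2 = quat_norm2 q.
Proof. by rewrite quat_normE sqr_sqrtr// quat_norm2_ge0. Qed.

Lemma sqr_normqim q : `|qim q| ^+ 2 = qi q ^+ 2 + qj q ^+ 2 + qk q ^+ 2.
Proof. by rewrite sqr_normq /quat_norm2 /= expr0n /= add0r. Qed.

Lemma exists_line q : exists2 I, imag_units I & complex_line I q.
Proof.
have [q0|q0] := eqVneq (qim q) 0.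
  exists (Quat 0 1 0 0).
    apply/imag_unitsP; split => //=.
    by rewrite quat_normE /quat_norm /quat_norm2 /= expr1n !expr0n /=
      !(addr0, add0r) sqrtr1.
  by exists (qre q, 0) => //; rewrite /slice_pt /= scale0r {2}[q]quat_re_im q0.
exists (`|qim q|^-1 *: qim q).
  apply/imag_unitsP; split; first by rewrite qreZ mulr0.
  by rewrite normrZ normrV ?unitfE ?normr_eq0// normr_id mulVf// normr_eq0.
exists (qre q, `|qim q|) => //; rewrite /slice_pt /= scalerA divff ?normr_eq0//.
by rewrite scale1r -quat_re_im.
Qed.

Lemma same_lineC p q : same_line p q -> same_line q p.
Proof. by move=> [I [? ? ?]]; exists I. Qed.

Lemma complex_lineE (I : H) q : imag_units I -> complex_line I q ->
  qim q = 0 \/ forall J, imag_units J -> complex_line J q ->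
    complex_line J `<=` complex_line I.
Proof.
move=> /imag_unitsP[I0 I1] [[x y] _ <-].
have lineE (K : H) (u v : R) : qre K = 0 ->
    qre (slice_pt K (u, v)) = u /\ qim (slice_pt K (u, v)) = v *: K.
  move=> K0; split; first by rewrite /slice_pt /= K0; ring.
  by apply: quat_ext; rewrite /slice_pt /= ?K0; ring.
have [_ ->] := lineE I x y I0.
have [->|y0] := eqVneq y 0; first by left; rewrite scale0r.
right=> J /imag_unitsP[J0 J1] [[u v] _ e] _ [[s t] _ <-].
have yv : v *: J = y *: I.
  by have [_ <-] := lineE J u v J0; have [_ <-] := lineE I x y I0; rewrite e.
have v0 : v != 0.
  apply: contra_neq y0 => v0; move: yv; rewrite v0 scale0r => /esym/eqP.
  by rewrite scaler_eq0 -(normr_eq0 I) I1 oner_eq0 orbF => /eqP.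
exists (s, t * (v^-1 * y)) => //; rewrite /slice_pt /=.
by rewrite -scalerA -scalerA -yv (scalerA _ v) mulVf// scale1r.
Qed.

Lemma norm_plane (x y : R) : `|Quat x y 0 0| = Num.sqrt (x ^+ 2 + y ^+ 2).
Proof. by rewrite quat_normE /quat_norm /quat_norm2 /= expr0n /= !addr0. Qed.

Lemma ler_plane (a b c d : R) :
  Num.sqrt ((a + c) ^+ 2 + (b + d) ^+ 2) <=
  Num.sqrt (a ^+ 2 + b ^+ 2) + Num.sqrt (c ^+ 2 + d ^+ 2).
Proof.
rewrite -!norm_plane; apply: le_trans (ler_normD _ _).
by rewrite le_eqVlt; apply/orP; left; apply/eqP; congr Num.norm;
  apply: quat_ext => /=; ring.
Qed.

Lemma norm_re_im q : `|q| = Num.sqrt (qre q ^+ 2 + `|qim q| ^+ 2).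
Proof. by rewrite sqr_normqim quat_normE /quat_norm /quat_norm2 !addrA. Qed.

Lemma qimB p q : qim (p - q) = qim p - qim q.
Proof. by apply: quat_ext; rewrite /= ?subrr. Qed.

Lemma norm_le_omega q p : `|q - p| <= omega_dist q p.
Proof.
rewrite norm_re_im /omega_dist ler_sqrt ?addr_ge0 ?sqr_ge0// lerD2l.
by rewrite ler_pXn2r ?nnegrE ?addr_ge0// qimB ler_normB.
Qed.

Lemma norm_le_sigma q p : `|q - p| <= sigma_dist q p.
Proof. by rewrite /sigma_dist; case: ifPn => // _; exact: norm_le_omega. Qed.

Lemma omega_distC q p : omega_dist q p = omega_dist p q.
Proof. by rewrite /omega_dist -sqrrN opprB [`|_| + _]addrC. Qed.

Lemma omega_triangle q p r :
  omega_dist p r <= omega_dist p q + `|q - r|.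
Proof.
have -> : omega_dist p r = Num.sqrt (((qre p - qre q) + (qre q - qre r)) ^+ 2
   + ((`|qim p| + `|qim q|) + (`|qim r| - `|qim q|)) ^+ 2).
  by congr (Num.sqrt (_ ^+ 2 + _ ^+ 2)); ring.
apply: le_trans (ler_plane _ _ _ _) _; apply: lerD => //.
rewrite (norm_re_im (q - r)) ler_sqrt ?addr_ge0 ?sqr_ge0// lerD2l qimB.
rewrite -[X in X <= _]real_normK ?num_real// ler_pXn2r ?nnegrE//.
by rewrite distrC ler_dist_dist.
Qed.

Lemma omega_real q p : qim q = 0 -> omega_dist p q = `|p - q|.
Proof.
by move=> q0; rewrite norm_re_im qimB /omega_dist q0 subr0 normr0 addr0.
Qed.

Let sigma_xx q : sigma_dist q q = 0.
Proof.
rewrite /sigma_dist; case: ifPn => [_|/asboolPn[]].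
  by rewrite subrr normr0.
by have [I] := exists_line q; exists I.
Qed.

Let sigma_eq0 q p : sigma_dist q p = 0 -> q = p.
Proof.
move=> e; apply/eqP; rewrite -subr_eq0 -normr_eq0 eq_le normr_ge0 andbT -e.
exact: norm_le_sigma.
Qed.

Let sigmaC q p : sigma_dist q p = sigma_dist p q.
Proof.
rewrite /sigma_dist (_ : same_line q p = same_line p q).
  by rewrite distrC omega_distC.
by apply/propext; split; exact: same_lineC.
Qed.

Let sigma_triangle q p r : sigma_dist p r <= sigma_dist p q + sigma_dist q r.
Proof.
rewrite [leLHS]/sigma_dist; case: ifPn => [_|/asboolPn pr].
  by apply: le_trans (lerD (norm_le_sigma _ _) (norm_le_sigma _ _));
    exact: ler_distD.
have [qp|qp] := pselect (same_line p q); last first.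
  rewrite [X in _ <= X + _]/sigma_dist asboolF//.
  by apply: le_trans (omega_triangle q p r) _; rewrite lerD2l norm_le_sigma.
have [qr|qr] := pselect (same_line q r); last first.
  rewrite addrC sigmaC omega_distC [X in _ <= X + _]/sigma_dist asboolF//;
    last by move=> /same_lineC.
  apply: le_trans (omega_triangle q r p) _; rewrite lerD2l distrC.
  exact: norm_le_sigma.
have q0 : qim q = 0.
  move: qp qr => [I [uI pI qI]] [J [uJ qJ rJ]].
  have [//|lIJ] := complex_lineE uI qI.
  by case: pr; exists I; split => //; exact: lIJ rJ.
apply: le_trans (omega_triangle q p r) _; rewrite omega_real//.
by rewrite lerD// norm_le_sigma.
Qed.

(* [quaternion R] with the distance sigma in place of the Euclidean one. *)
Definition sigma_quaternion : Type := H.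

HB.instance Definition _ := Choice.on sigma_quaternion.
HB.instance Definition _ := @isMetric.Build R sigma_quaternion
  sigma_dist sigma_xx sigma_eq0 sigmaC sigma_triangle.

End Sigma.

Section SigmaAnalytic.
Variable R : realType.
Local Notation H := (quaternion R).

(* Value at q of a polynomial with coefficients on the right. The library's
   [P.[q]] puts them on the left. *)
Definition right_horner (P : {poly H}) (q : H) : H :=
  \sum_(i < size P) q ^+ i * P`_i.

(* (q - p)^{*n}: in [{poly H}] the variable commutes with the coefficients and
   the product is (P * Q)`_n = \sum_(k <= n) P`_k * Q`_(n - k), which is the
   regular multiplication. *)
Definition regular_pow (p : H) (n : nat) (q : H) : H :=
  right_horner (('X - p%:P) ^+ n) q.

Definition sigma_analytic_at (Omega : set H) (f : H -> H) (p : H) :=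
  exists (U : set H) (b : nat -> H),
    [/\ U `<=` Omega,
        @nbhs _ (sigma_quaternion R) p U &
        forall q, U q ->
          series (fun n => regular_pow p n q * b n) @ \oo --> f q].

Definition sigma_analytic (Omega : set H) (f : H -> H) :=
  forall p, Omega p -> sigma_analytic_at Omega f p.

End SigmaAnalytic.

(* Main.v *)
(* Restricted to a complex line through p, a slice regular function is an
   H-valued holomorphic function of one complex variable, H being a left vector
   space over the line.  Goursat's bisection argument gives the vanishing of its
   integral along rectangles, and then its expansion in powers of q - p on a
   square around p, using only that integrals of continuous functions are
   additive, linear and bounded: the moments of (q - p)^(-n) are evaluated by
   enlarging the square.  Conversely a convergent power series on a line is
   holomorphic there, by a second order Taylor estimate for the monomials.
   For p not real, small balls for sigma are discs in the line of p.  For p real,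
   they are Euclidean balls, and the expansions on all lines share the same
   coefficients, which are determined by the values on the real axis. *)
Require Import Defs.
From HB Require Import structures.
From mathcomp Require Import all_boot all_order all_algebra.
From mathcomp Require Import boolp classical_sets functions reals topology
  normedtype.
From mathcomp Require Import prodnormedzmodule landau sequences derive.
From mathcomp Require Import interval_inference constructive_ereal.
From mathcomp Require Import measure lebesgue_measure lebesgue_integral.
From mathcomp Require Import ring lra.
Import numFieldNormedType.Exports.

Set Implicit Arguments.
Unset Strict Implicit.
Unset Printing Implicit Defensive.

Import Order.TTheory GRing.Theory Num.Theory.

Local Open Scope classical_set_scope.
Local Open Scope ring_scope.

(** * Quaternion arithmetic and complex lines *)

Section Division.
Variable R : realType.
Local Notation H := (quaternion R).
Implicit Types p q : H.

(** Noncommutativity dictates the form of the statements. Increments, powers and kernels stand on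
    the left, values, derivatives and coefficients on the right, and factors are exchanged only when
    both lie on the line. A regular power reduces to an ordinary power at points commuting with the
    centre, so everything is done with ordinary powers on one line, and sigma-balls around a nonreal
    [p] get radius at most [|qim p|] in order to stay on that line. Holomorphy is an epsilon
    estimate with increments confined to the line, so H needs no second scalar structure. Contours
    are boundaries of rectangles in the coordinates (x, y), so that one-variable integrals suffice.
    The number 2 pi is never computed: the integral of the inverse around a square is [I] times some
    positive real, which is divided out of the coefficients. *)

Lemma quat_normM p q : `|p * q| = `|p| * `|q|.
Proof.
rewrite !quat_normE /quat_norm -sqrtrM ?quat_norm2_ge0//; congr Num.sqrt.
by case: p q => [a b c d] [a' b' c' d']; rewrite /quat_norm2 /=; ring.
Qed.

Lemma quat_norm1 : `|1 : H| = 1.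
Proof.
by rewrite quat_normE /quat_norm /quat_norm2 /= expr1n !expr0n /= !addr0 sqrtr1.
Qed.

Lemma quat_normX q n : `|q ^+ n| = `|q| ^+ n.
Proof.
by elim: n => [|n IH]; rewrite ?expr0 ?quat_norm1// !exprS quat_normM IH.
Qed.

(** The conjugate over the squared norm. Since [0^-1 = 0] in [R], the value at 0 is 0, as the total
    inverse of the ring interface demands. *)
Definition quat_inv q : H :=
  (quat_norm2 q)^-1 *: Quat (qre q) (- qi q) (- qj q) (- qk q).

Lemma quat_norm2_eq0 q : (quat_norm2 q == 0) = (q == 0).
Proof. by rewrite -sqr_normq sqrf_eq0 normr_eq0. Qed.

(** The scalar [s] stands for [quat_norm2 q]; kept abstract, it leaves polynomial identities. *)
Let quat_conjM (s : R) q :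
  s^-1 *: Quat (qre q) (- qi q) (- qj q) (- qk q) * q = (s^-1 * quat_norm2 q)%:A
  /\ q * (s^-1 *: Quat (qre q) (- qi q) (- qj q) (- qk q))
     = (s^-1 * quat_norm2 q)%:A.
Proof.
by rewrite -scalerAl -scalerAr; case: q => a b c d; split;
  apply: quat_ext; rewrite /quat_norm2 /=; ring.
Qed.

Let quat_mulVq : {in [pred q | q != 0], left_inverse 1 quat_inv *%R}.
Proof.
move=> q q0; rewrite /quat_inv (quat_conjM _ q).1 mulVf ?scale1r//.
by rewrite quat_norm2_eq0.
Qed.

Let quat_mulqV : {in [pred q | q != 0], right_inverse 1 quat_inv *%R}.
Proof.
move=> q q0; rewrite /quat_inv (quat_conjM _ q).2 mulVf ?scale1r//.
by rewrite quat_norm2_eq0.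
Qed.

Let quat_unitP p q : q * p = 1 /\ p * q = 1 -> p \in [pred q | q != 0].
Proof.
move=> [qp _]; rewrite inE; apply/eqP => p0; move: qp; rewrite p0 mulr0.
by move=> /esym/eqP; rewrite oner_eq0.
Qed.

Let quat_inv_out : {in [predC [pred q | q != 0]], quat_inv =1 id}.
Proof.
move=> q; rewrite !inE negbK => /eqP ->.
by apply: quat_ext; rewrite /= ?oppr0 mulr0.
Qed.

HB.instance Definition _ := GRing.NzRing_hasMulInverse.Build H
  quat_mulVq quat_mulqV quat_unitP quat_inv_out.

Lemma quat_unitE q : (q \is a GRing.unit) = (q != 0).
Proof. by []. Qed.

Lemma quat_normV q : q != 0 -> `|q^-1| = `|q|^-1.
Proof.
move=> q0; have nq : `|q| != 0 by rewrite normr_eq0.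
by apply: (mulfI nq); rewrite -quat_normM divrr ?quat_unitE// mulfV//
  quat_norm1.
Qed.

End Division.

(** * Complex lines as commutants of their imaginary unit *)

Section Line.
Variables (R : realType) (I : quaternion R).
Local Notation H := (quaternion R).
Hypothesis uI : imag_units I.
Implicit Types (p q : H) (z : R * R).

Lemma slice_ptE z : slice_pt I z =
  Quat z.1 (z.2 * qi I) (z.2 * qj I) (z.2 * qk I).
Proof.
have [I0 _] := (imag_unitsP I).1 uI.
by apply: quat_ext; rewrite /slice_pt /= ?I0; ring.
Qed.

Lemma slice_ptD z w : slice_pt I (z + w) = slice_pt I z + slice_pt I w.
Proof. by rewrite /slice_pt /= !scalerDl addrACA. Qed.

Lemma slice_ptB z w : slice_pt I (z - w) = slice_pt I z - slice_pt I w.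
Proof. by rewrite /slice_pt /= !scalerBl opprD addrACA. Qed.

(** Commuting with [I] means that the cross product of [I] and [qim q] vanishes, so [qim q] is a
    multiple of [I]. The stability of the line under sums, powers and inverses then comes from that
    of a commutant. *)
Lemma complex_line_comm q : complex_line I q <-> GRing.comm I q.
Proof.
have [I0 I1] := (imag_unitsP I).1 uI.
split=> [[z _ <-]|].
  by rewrite /GRing.comm /slice_pt mulrDr mulrDl -!scalerAr -!scalerAl mulr1
    mul1r.
have n1 : qi I ^+ 2 + qj I ^+ 2 + qk I ^+ 2 = 1.
  by have := sqr_normq I; rewrite I1 /quat_norm2 I0 !expr2 mulr1 mulr0 add0r =>
    ->.
move=> cIq.
(* The second coordinate is the scalar product of [qim q] with the unit vector [I]. *)
exists (qre q, qi q * qi I + qj q * qj I + qk q * qk I) => //.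
have e1 := congr1 (@qi R) cIq; have e2 := congr1 (@qj R) cIq.
have e3 := congr1 (@qk R) cIq; rewrite slice_ptE; move: e1 e2 e3 => /=.
rewrite I0 !mul0r !mulr0 !(add0r, addr0) => e1 e2 e3.
have e12 : qi I * qj q = qj I * qi q by lra.
have e13 : qi I * qk q = qk I * qi q by lra.
have e23 : qj I * qk q = qk I * qj q by lra.
apply: quat_ext => //=.
- rewrite -[RHS]mulr1 -n1; transitivity (qi q * qi I ^+ 2
    + (qi I * qj q) * qj I + (qi I * qk q) * qk I); first by ring.
  by rewrite e12 e13; ring.
- rewrite -[RHS]mulr1 -n1; transitivity ((qj I * qi q) * qi I
    + qj q * qj I ^+ 2 + (qj I * qk q) * qk I); first by ring.
  by rewrite -e12 e23; ring.
- rewrite -[RHS]mulr1 -n1; transitivity ((qk I * qi q) * qi I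
    + (qk I * qj q) * qj I + qk q * qk I ^+ 2); first by ring.
  by rewrite -e13 -e23; ring.
Qed.

Lemma line_pt z : complex_line I (slice_pt I z).
Proof. by exists z. Qed.

Lemma line_real (a : R) : complex_line I a%:A.
Proof. by exists (a, 0) => //; rewrite /slice_pt /= scale0r addr0. Qed.

Lemma line0 : complex_line I 0.
Proof. by have := line_real 0; rewrite scale0r. Qed.

Lemma line_unit : complex_line I I.
Proof. by apply/complex_line_comm. Qed.

Lemma lineD p q : complex_line I p -> complex_line I q ->
  complex_line I (p + q).
Proof. by move=> /complex_line_comm ? /complex_line_comm ?;
  apply/complex_line_comm/commrD. Qed.

Lemma lineN p : complex_line I p -> complex_line I (- p).
Proof. by move=> /complex_line_comm ?; apply/complex_line_comm/commrN. Qed.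

Lemma lineB p q : complex_line I p -> complex_line I q ->
  complex_line I (p - q).
Proof. by move=> ? ?; apply: lineD => //; exact: lineN. Qed.

Lemma lineX p n : complex_line I p -> complex_line I (p ^+ n).
Proof. by move=> /complex_line_comm ?; apply/complex_line_comm/commrX. Qed.

Lemma lineV p : complex_line I p -> complex_line I p^-1.
Proof. by move=> /complex_line_comm ?; apply/complex_line_comm/commrV. Qed.

Lemma line_comm p q : complex_line I p -> complex_line I q -> p * q = q * p.
Proof.
move=> [z _ <-] [w _ <-]; rewrite !slice_ptE.
by apply: quat_ext => /=; ring.
Qed.

Lemma norm_slice_pt z : `|slice_pt I z| = Num.sqrt (z.1 ^+ 2 + z.2 ^+ 2).
Proof.
have [I0 I1] := (imag_unitsP I).1 uI.
have n1 : qi I ^+ 2 + qj I ^+ 2 + qk I ^+ 2 = 1.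
  by have := sqr_normq I; rewrite I1 /quat_norm2 I0 !expr2 mulr1 mulr0 add0r =>
    ->.
rewrite slice_ptE quat_normE /quat_norm /quat_norm2 /=; congr Num.sqrt.
by rewrite -!addrA; congr (_ + _); rewrite -[RHS]mulr1 -n1; ring.
Qed.

Lemma norm_slice_pt_le z : `|slice_pt I z| <= `|z.1| + `|z.2|.
Proof.
have [_ I1] := (imag_unitsP I).1 uI.
by rewrite (le_trans (ler_normD _ _))// !normrZ I1 quat_norm1 !mulr1.
Qed.

Lemma ge_slice_pt1 z : `|z.1| <= `|slice_pt I z|.
Proof. by rewrite norm_slice_pt -sqrtr_sqr ler_wsqrtr// lerDl sqr_ge0. Qed.

Lemma ge_slice_pt2 z : `|z.2| <= `|slice_pt I z|.
Proof. by rewrite norm_slice_pt -sqrtr_sqr ler_wsqrtr// lerDr sqr_ge0. Qed.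

End Line.

(** * Integration of quaternion-valued functions *)

Section Integral.
Variable R : realType.
Local Notation H := (quaternion R).
Local Notation mu := (@lebesgue_measure R).
Implicit Types (a b m : R) (q : H).

Lemma ler_qre q : `|qre q| <= `|q|.
Proof.
rewrite -sqrtr_sqr quat_normE ler_wsqrtr// /quat_norm2 -!addrA lerDl.
by rewrite !addr_ge0 ?sqr_ge0.
Qed.

Lemma ler_qi q : `|qi q| <= `|q|.
Proof.
rewrite -sqrtr_sqr quat_normE ler_wsqrtr// /quat_norm2.
have -> : qre q ^+ 2 + qi q ^+ 2 + qj q ^+ 2 + qk q ^+ 2 =
  qi q ^+ 2 + (qre q ^+ 2 + qj q ^+ 2 + qk q ^+ 2) by ring.
by rewrite lerDl !addr_ge0 ?sqr_ge0.
Qed.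

Lemma ler_qj q : `|qj q| <= `|q|.
Proof.
rewrite -sqrtr_sqr quat_normE ler_wsqrtr// /quat_norm2.
have -> : qre q ^+ 2 + qi q ^+ 2 + qj q ^+ 2 + qk q ^+ 2 =
  qj q ^+ 2 + (qre q ^+ 2 + qi q ^+ 2 + qk q ^+ 2) by ring.
by rewrite lerDl !addr_ge0 ?sqr_ge0.
Qed.

Lemma ler_qk q : `|qk q| <= `|q|.
Proof.
rewrite -sqrtr_sqr quat_normE ler_wsqrtr// /quat_norm2.
have -> : qre q ^+ 2 + qi q ^+ 2 + qj q ^+ 2 + qk q ^+ 2 =
  qk q ^+ 2 + (qre q ^+ 2 + qi q ^+ 2 + qj q ^+ 2) by ring.
by rewrite lerDl !addr_ge0 ?sqr_ge0.
Qed.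

Lemma quat_norm_le q : `|q| <= `|qre q| + `|qi q| + `|qj q| + `|qk q|.
Proof.
have sq (x : R) : x ^+ 2 = `|x| ^+ 2 by rewrite -normrX ger0_norm// sqr_ge0.
rewrite quat_normE -[leRHS]ger0_norm ?addr_ge0// -sqrtr_sqr; apply: ler_wsqrtr.
rewrite /quat_norm2 (sq (qre q)) (sq (qi q)) (sq (qj q)) (sq (qk q)).
move: (normr_ge0 (qre q)) (normr_ge0 (qi q)) (normr_ge0 (qj q)) (normr_ge0 (qk
  q)).
move: `|qre q| `|qi q| `|qj q| `|qk q| => x y z t x0 y0 z0 t0;
  rewrite -subr_ge0.
have -> : (x + y + z + t) ^+ 2 - (x ^+ 2 + y ^+ 2 + z ^+ 2 + t ^+ 2) =
  (x * y + x * z + x * t + y * z + y * t + z * t) *+ 2 by ring.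
by apply: mulrn_wge0; rewrite !addr_ge0// mulr_ge0.
Qed.

(** Continuity as a function on the whole of [R], also at the endpoints. Holomorphy at a point
    concerns all nearby points of the line and supplies this stronger form. *)
Definition cont_on (V : normedModType R) a b (u : R -> V) :=
  forall x, a <= x <= b -> {for x, continuous u}.

Lemma cont_on_comp (V W : normedModType R) a b (u : R -> V) (g : V ->
  W) (k : R) :
  (forall x y, `|g x - g y| <= k * `|x - y|) ->
  cont_on a b u -> cont_on a b (g \o u).
Proof.
move=> gk cu x xab; apply/cvgrPdist_lt => e e0 /=.
have k1 : 0 < `|k| + 1 by rewrite ltr_wpDl.
have /cvgrPdist_lt/(_ (e / (`|k| + 1))) := cu x xab.
rewrite divr_gt0// => /(_ isT); apply: filterS => y; rewrite ltr_pdivlMr// => h.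
apply: le_lt_trans (gk _ _) _; apply: le_lt_trans h.
rewrite mulrC ler_wpM2l//; apply: le_trans (ler_norm k) _; lra.
Qed.

Definition rint a b (u : R -> R) := \int[mu]_(x in `[a, b]) u x.

Lemma cont_on_integrable a b (u : R -> R) :
  cont_on a b u -> mu.-integrable `[a, b] (EFin \o u).
Proof.
move=> cu; apply: continuous_compact_integrable; first exact: segment_compact.
by apply: continuous_in_subspaceT => x; rewrite inE /= in_itv /= => /cu.
Qed.

Lemma rint_lin a b (u v : R -> R) (k l : R) : cont_on a b u -> cont_on a b v ->
  rint a b (fun x => k * u x + l * v x) = k * rint a b u + l * rint a b v.
Proof.
move=> cu cv; have iu := cont_on_integrable cu;
  have iv := cont_on_integrable cv.
rewrite /rint RintegralD//=; last 2 first.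
- exact: (integrableZl _ k iu).
- exact: (integrableZl _ l iv).
by rewrite !RintegralZl.
Qed.

Lemma cont_on_lin (V : normedModType R) a b (u v : R -> V) (k l : R) :
  cont_on a b u -> cont_on a b v ->
  cont_on a b (fun x => k *: u x + l *: v x).
Proof.
move=> cu cv x xab; apply: cvgD; apply: cvgZ => //; try exact: cvg_cst.
- exact: cu.
- exact: cv.
Qed.

Lemma rint_cst a b k : a <= b -> rint a b (fun=> k) = (b - a) * k.
Proof.
move=> ab; rewrite /rint Rintegral_cst//= lebesgue_measure_itv /= lte_fin.
by case: ltgtP ab => //= [ab _|-> _]; rewrite ?subrr /= mulrC.
Qed.

Lemma rint_split a m b u : a <= m -> m <= b -> cont_on a b u ->
  rint a b u = rint a m u + rint m b u.
Proof.
move=> am mb cu; have iu := cont_on_integrable cu.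
have := @Rintegral_itvB R u (BLeft a) (BRight b) m iu.
rewrite !bnd_simp => /(_ am mb); rewrite /rint Rintegral_itv_obnd_cbnd//.
  by move=> <-; rewrite addrC subrK.
apply: integrableS iu => // x /=; rewrite !in_itv /= => /andP[/ltW ? ->].
by rewrite andbT (le_trans am).
Qed.

Lemma rint_norm_le a b u (M : R) : a <= b -> cont_on a b u ->
  (forall x, a <= x <= b -> `|u x| <= M) -> `|rint a b u| <= M * (b - a).
Proof.
move=> ab cu uM; have iu := cont_on_integrable cu.
apply: le_trans (le_normr_Rintegral _ iu) _ => //.
rewrite mulrC -rint_cst// /rint; apply: le_Rintegral => //.
- exact: integrable_abse iu.
- by apply: cont_on_integrable => x _; exact: cvg_cst.
Qed.

Definition qint a b (u : R -> H) : H :=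
  Quat (rint a b (@qre R \o u)) (rint a b (@qi R \o u))
       (rint a b (@qj R \o u)) (rint a b (@qk R \o u)).

Lemma cont_on_parts a b (u : R -> H) : cont_on a b u ->
  [/\ cont_on a b (@qre R \o u), cont_on a b (@qi R \o u),
      cont_on a b (@qj R \o u) & cont_on a b (@qk R \o u)].
Proof.
move=> cu; split; apply: (@cont_on_comp _ R^o _ _ _ _ 1 _ cu) => p q;
  rewrite mul1r.
- exact: ler_qre (p - q).
- exact: ler_qi (p - q).
- exact: ler_qj (p - q).
- exact: ler_qk (p - q).
Qed.

Lemma qint_lin a b (u v : R -> H) (k l : R) : cont_on a b u -> cont_on a b v ->
  qint a b (fun x => k *: u x + l *: v x) = k *: qint a b u + l *: qint a b v.
Proof.
move=> /cont_on_parts[u1 u2 u3 u4] /cont_on_parts[v1 v2 v3 v4].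
by rewrite /qint; apply: quat_ext; rewrite !quatE /= -rint_lin.
Qed.

Lemma qintD a b (u v : R -> H) : cont_on a b u -> cont_on a b v ->
  qint a b (fun x => u x + v x) = qint a b u + qint a b v.
Proof.
move=> cu cv; rewrite -[in RHS](scale1r (qint a b u)) -(scale1r (qint a b v)).
by rewrite -qint_lin//; congr qint; apply/funext => x; rewrite !scale1r.
Qed.

(** Each component of a quaternion product is a real combination of the four components of one
    factor, hence the four terms. *)
Lemma rint_lin4 a b (u1 u2 u3 u4 : R -> R) (k1 k2 k3 k4 : R) :
  cont_on a b u1 -> cont_on a b u2 -> cont_on a b u3 -> cont_on a b u4 ->
  rint a b (fun x => k1 * u1 x + k2 * u2 x + k3 * u3 x + k4 * u4 x) =
  k1 * rint a b u1 + k2 * rint a b u2 + k3 * rint a b u3 + k4 * rint a b u4.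
Proof.
move=> c1 c2 c3 c4; rewrite -addrA -!rint_lin// -[RHS]mul1r mulrDr.
rewrite -rint_lin; [|exact: (@cont_on_lin R^o)..].
by congr rint; apply/funext => x; rewrite !mul1r addrA.
Qed.

Lemma qint_mull a b (u : R -> H) q : cont_on a b u ->
  qint a b (fun x => q * u x) = q * qint a b u.
Proof.
move=> /cont_on_parts[u1 u2 u3 u4]; rewrite /qint.
apply: quat_ext => /=; rewrite -?mulNr -rint_lin4//; congr rint;
  by apply/funext => x /=; ring.
Qed.

Lemma qint_mulr a b (u : R -> H) q : cont_on a b u ->
  qint a b (fun x => u x * q) = qint a b u * q.
Proof.
move=> /cont_on_parts[u1 u2 u3 u4]; rewrite /qint.
apply: quat_ext => /=; rewrite ![rint _ _ _ * _]mulrC -?mulNr -rint_lin4//;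
  congr rint; by apply/funext => x /=; ring.
Qed.

Lemma cont_on_mull a b (u : R -> H) q : cont_on a b u ->
  cont_on a b (fun x => q * u x).
Proof.
move=> cu; apply: (@cont_on_comp _ _ _ _ u (fun p => q * p) `|q|) => // p r.
by rewrite -mulrBr quat_normM.
Qed.

Lemma cont_on_mulr a b (u : R -> H) q : cont_on a b u ->
  cont_on a b (fun x => u x * q).
Proof.
move=> cu; apply: (@cont_on_comp _ _ _ _ u (fun p => p * q) `|q|) => // p r.
by rewrite -mulrBl quat_normM mulrC.
Qed.

Lemma qint_cst a b q : a <= b -> qint a b (fun=> q) = (b - a) *: q.
Proof. by move=> ab; apply: quat_ext; rewrite /= -rint_cst. Qed.

Lemma qint_split a m b u : a <= m -> m <= b -> cont_on a b u ->
  qint a b u = qint a m u + qint m b u.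
Proof.
move=> am mb /cont_on_parts[u1 u2 u3 u4].
by apply: quat_ext; rewrite /= -rint_split.
Qed.

(** The factor 4 comes from bounding the four components separately; later estimates use only the
    order of magnitude. *)
Lemma qint_norm_le a b u (M : R) : a <= b -> cont_on a b u ->
  (forall x, a <= x <= b -> `|u x| <= M) -> `|qint a b u| <= 4 * M * (b - a).
Proof.
move=> ab /cont_on_parts[u1 u2 u3 u4] uM;
  apply: le_trans (quat_norm_le _) _ => /=.
have -> : 4 * M * (b - a) = M * (b - a) + M * (b - a) + M * (b - a) + M * (b -
  a) by ring.
rewrite !lerD// rint_norm_le// => x xab; apply: le_trans (uM x xab) => /=.
- exact: ler_qre.
- exact: ler_qi.
- exact: ler_qj.
- exact: ler_qk.
Qed.

Lemma eq_qint a b (u v : R -> H) : (forall x, a <= x <= b -> u x = v x) ->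
  qint a b u = qint a b v.
Proof.
by move=> uv; apply: quat_ext; apply: eq_Rintegral => x;
  rewrite inE /= in_itv /= => /uv ->.
Qed.

Lemma cont_on_bounded a b (u : R -> H) : a <= b -> cont_on a b u ->
  exists2 M, 0 <= M & forall x, a <= x <= b -> `|u x| <= M.
Proof.
move=> ab cu.
have cn : {within `[a, b], continuous (fun x => `|u x|)}.
  apply: continuous_in_subspaceT => x; rewrite inE /= in_itv /= => xab.
  apply: (@cont_on_comp _ R^o a b u (fun q => `|q|) 1) => // p q.
  by rewrite mul1r ler_dist_dist.
have [c cab uc] := EVT_max ab cn.
by exists `|u c| => // x xab; apply: uc; rewrite in_itv.
Qed.

End Integral.

(** * Holomorphy on a complex line *)

Section Holomorphy.
Variables (R : realType) (I : quaternion R).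
Local Notation H := (quaternion R).
Hypothesis uI : imag_units I.
Local Notation L := (complex_line I).
Implicit Types (p q A : H) (k u v : H -> H).

(** The increment multiplies the derivative from the left: in coordinates the partial derivatives
    are [A] and [I * A], which is the equation ['D_(1, 0) + I * 'D_(0, 1) = 0] of slice regularity.
    [A] need not lie on the line. *)
Definition slice_deriv k p A := forall e : R, 0 < e ->
  exists2 d : R, 0 < d & forall q, L q -> `|q - p| < d ->
    `|k q - k p - (q - p) * A| <= e * `|q - p|.

Definition hol k p := exists A, slice_deriv k p A.

Lemma hol_lip k p : hol k p -> exists C d : R, [/\ 0 < C, 0 < d &
  forall q, L q -> `|q - p| < d -> `|k q - k p| <= C * `|q - p|].
Proof.
move=> [A /(_ 1 ltr01)[d d0 kd]].
exists (1 + `|A|), d; split; [by rewrite ltr_wpDr|by []|].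
move=> q Lq qp; rewrite -[X in `|X|](subrK ((q - p) * A)).
by apply: le_trans (ler_normD _ _) _; rewrite (mulrDl 1); apply: lerD;
  [exact: kd|rewrite quat_normM mulrC].
Qed.

Lemma hol_cont k p : hol k p -> forall e : R, 0 < e -> exists2 d : R, 0 < d &
  forall q, L q -> `|q - p| < d -> `|k q - k p| < e.
Proof.
move=> /hol_lip[C [d [C0 d0 kC]]] e e0.
exists (Num.min d (e / C)); first by rewrite lt_min d0 divr_gt0.
move=> q Lq; rewrite lt_min => /andP[qd qe].
by apply: le_lt_trans (kC _ Lq qd) _; rewrite mulrC -ltr_pdivlMr.
Qed.

Lemma hol_cst q p : hol (fun=> q) p.
Proof.
by exists 0 => e e0; exists 1 => // r _ _;
  rewrite subrr mulr0 subrr normr0 mulr_ge0// ltW.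
Qed.

Lemma hol_id p : hol id p.
Proof.
by exists 1 => e e0; exists 1 => // r _ _;
  rewrite mulr1 subrr normr0 mulr_ge0// ltW.
Qed.

Lemma hol_add u v p : hol u p -> hol v p -> hol (fun q => u q + v q) p.
Proof.
move=> [A uA] [B vB]; exists (A + B) => e e0.
have e2 : 0 < e / 2 by rewrite divr_gt0.
have [d d0 ud] := uA _ e2; have [d' d'0 vd] := vB _ e2.
exists (Num.min d d'); first by rewrite lt_min d0.
move=> q Lq; rewrite lt_min => /andP[qd qd'].
have -> : u q + v q - (u p + v p) - (q - p) * (A + B) =
  (u q - u p - (q - p) * A) + (v q - v p - (q - p) * B).
  by apply: quat_ext => /=; ring.
by apply: le_trans (ler_normD _ _) _; rewrite [e]splitr (mulrDl (e / 2));
  apply: lerD; [exact: ud|exact: vd].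
Qed.

Lemma hol_mulr u A p : hol u p -> hol (fun q => u q * A) p.
Proof.
move=> [B uB]; exists (B * A) => e e0.
have A1 : 0 < `|A| + 1 by rewrite ltr_wpDl.
have [d d0 ud] := uB _ (divr_gt0 e0 A1).
exists d => // q Lq qd; rewrite mulrA -!mulrBl quat_normM.
apply: le_trans (ler_wpM2r (normr_ge0 A) (ud _ Lq qd)) _.
rewrite mulrAC ler_wpM2r// -mulrA ler_piMr// ?(ltW e0)//.
by rewrite mulrC ler_pdivrMr// mul1r lerDl.
Qed.

Lemma hol_opp u p : hol u p -> hol (fun q => - u q) p.
Proof.
move=> /(hol_mulr (-1)); congr (hol _ p).
by apply/funext => q; rewrite mulrN1.
Qed.

Lemma hol_sub u v p : hol u p -> hol v p -> hol (fun q => u q - v q) p.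
Proof. by move=> hu hv; apply: hol_add => //; exact: hol_opp. Qed.

(* Left multiplication by [u p] commutes with the increment [q - p] because
   both lie on the line. *)
Lemma hol_mul u v p : L p -> L (u p) -> hol u p -> hol v p ->
  hol (fun q => u q * v q) p.
Proof.
move=> Lp Lup hu [B vB]; have [A uA] := hu.
exists (u p * B + A * v p) => e e0.
have [C [d1 [C0 d10 uC]]] := hol_lip hu.
(* [K] dominates the cofactors of the three error terms below: [|u q|], at most [|u p| + C * d1],
   then [C * |B|], then [|v p|]. Each term gets a third of [e]. The radius [e / K / 3] serves the
   middle one, which is quadratic in [|q - p|]. *)
pose K := `|u p| + C * d1 + C * `|B| + `|v p| + 1.
have K0 : 0 < K.
  by rewrite /K ltr_wpDl// !addr_ge0// mulr_ge0// ltW.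
have e3 : 0 < e / K / 3 by rewrite !divr_gt0.
have [d2 d20 ud] := uA _ e3; have [d3 d30 vd] := vB _ e3.
exists (Num.min (Num.min d1 (e / K / 3)) (Num.min d2 d3)).
  by rewrite !lt_min d10 d20 d30 e3.
move=> q Lq; rewrite !lt_min => /andP[/andP[qd1 qe] /andP[qd2 qd3]].
have -> : u q * v q - u p * v p - (q - p) * (u p * B + A * v p) =
    u q * (v q - v p - (q - p) * B) + (u q - u p) * ((q - p) * B)
    + (u q - u p - (q - p) * A) * v p.
  have -> : (q - p) * (u p * B + A * v p) = u p * ((q - p) * B) + (q - p) * A *
    v p.
    by rewrite mulrDr !mulrA (line_comm uI (lineB uI Lq Lp) Lup).
  rewrite !mulrBr !mulrBl; move: (u q) (u p) (v q) (v p) => a b c d.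
  move: (a * c) (b * d) (a * d) (a * _) (a * _) (b * _) (b * _) (q * A * d) (p
    * A * d) => *.
  by apply: quat_ext => /=; ring.
set t := `|q - p|; have t0 : 0 <= t by exact: normr_ge0.
have uqle : `|u q| <= `|u p| + C * d1.
  rewrite -[u q](subrK (u p)) addrC; apply: le_trans (ler_normD _ _) _.
  rewrite lerD2l; apply: le_trans (uC _ Lq qd1) _.
  by apply: ler_wpM2l; apply: ltW.
have h1 : `|u q * (v q - v p - (q - p) * B)| <= K * (e / K / 3 * t).
  rewrite quat_normM; apply: ler_pM => //; last exact: vd.
  apply: le_trans uqle _; rewrite /K -!addrA lerD2l lerDl.
  by rewrite !addr_ge0// mulr_ge0// ltW.
have h2 : `|(u q - u p) * ((q - p) * B)| <= K * (e / K / 3 * t).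
  rewrite !quat_normM -/t; apply: (@le_trans _ _ ((C * t) * (t * `|B|))).
    by rewrite ler_wpM2r ?mulr_ge0// uC.
  have -> : C * t * (t * `|B|) = (C * `|B|) * (t * t) by ring.
  apply: ler_pM; rewrite ?mulr_ge0// ?(ltW C0)//.
    have -> : K = C * `|B| + (`|u p| + C * d1 + `|v p| + 1) by rewrite /K; ring.
    by rewrite lerDl !addr_ge0// mulr_ge0// ltW.
  by rewrite ler_wpM2r// ltW.
have h3 : `|(u q - u p - (q - p) * A) * v p| <= K * (e / K / 3 * t).
  rewrite quat_normM mulrC; apply: ler_pM => //; last exact: ud.
  have -> : K = `|v p| + (`|u p| + C * d1 + C * `|B| + 1) by rewrite /K; ring.
  by rewrite lerDl !addr_ge0// mulr_ge0// ltW.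
have eK : e * t = K * (e / K / 3 * t) + K * (e / K / 3 * t) + K * (e / K / 3 *
  t).
  by field; rewrite gt_eqF.
rewrite eK (le_trans (ler_normD _ _))// lerD// (le_trans (ler_normD _ _))//.
by rewrite lerD.
Qed.

(** With [a = p - z] and [b = q - z], the remainder is exactly [(q - p)^2 * a^-2 * b^-1], because
    all factors commute on the line. *)
Lemma hol_inv z p : L z -> L p -> p != z -> hol (fun q => (q - z)^-1) p.
Proof.
move=> Lz Lp pz; have a0 : p - z != 0 by rewrite subr_eq0.
have na : 0 < `|p - z| by rewrite normr_gt0.
set a := p - z in a0 na *.
exists (- (a^-1 * a^-1)) => e e0.
(* The first bound keeps [|b|] at least [|a| / 2]; the second solves [2 * t^2 / |a|^3 <= e * t] for
   [t = |q - p|]. *)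
exists (Num.min (`|a| / 2) (e * `|a| ^+ 3 / 2)).
  by rewrite lt_min !divr_gt0// mulr_gt0// exprn_gt0.
move=> q Lq; rewrite lt_min => /andP[qa qe].
have bE : q - z = (q - p) + a by rewrite /a addrA subrK.
set b := q - z in bE *.
have nb : `|a| / 2 <= `|b|.
  rewrite bE addrC -[q - p]opprK; apply: le_trans (lerB_dist _ _).
  by rewrite normrN; lra.
have b0 : b != 0 by rewrite -normr_gt0 (lt_le_trans _ nb)// divr_gt0.
have La : L a by exact: lineB.
have Lb : L b by exact: lineB.
have qpE : q - p = b - a by rewrite bE addrK.
have -> : b^-1 - a^-1 - (q - p) * - (a^-1 * a^-1) =
    (q - p) * (q - p) * (a^-1 * a^-1 * b^-1).
  have Lx : L a^-1 by exact: lineV.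
  have xy : a^-1 * b^-1 = b^-1 * a^-1 by apply: (line_comm uI) => //;
    exact: lineV.
  have cxy : (b - a) * (a^-1 * b^-1) = a^-1 - b^-1.
    by rewrite mulrBl {1}xy !mulrA !divrr// !mul1r.
  have e1 : (b - a) * (a^-1 * a^-1 * b^-1) = a^-1 * (a^-1 - b^-1).
    rewrite -cxy -(mulrA a^-1 a^-1 b^-1) (mulrA (b - a) a^-1 (a^-1 / b)).
    by rewrite (line_comm uI (lineB uI Lb La) Lx) -mulrA.
  rewrite qpE mulrN opprK -mulrA e1 (mulrBr a^-1) (mulrBr (b - a)) cxy.
  by rewrite -[b^-1 - a^-1]opprB addrC.
rewrite quat_normM !quat_normM !quat_normV//.
set t := `|q - p|; have t0 : 0 <= t by exact: normr_ge0.
rewrite -mulrA [leRHS]mulrC ler_wpM2l//.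
apply: (@le_trans _ _ (e * `|a| ^+ 3 / 2 * (`|a|^-1 / `|a| * (`|a| / 2)^-1))).
  rewrite ler_pM ?mulr_ge0 ?invr_ge0// ?(ltW qe)// ler_wpM2l//.
  by rewrite lef_pV2 ?posrE ?normr_gt0 ?divr_gt0.
by rewrite le_eqVlt; apply/orP; left; apply/eqP; field; rewrite gt_eqF.
Qed.

End Holomorphy.

(** * Integrals along rectangles *)

Section Rectangles.
Variables (R : realType) (I : quaternion R).
Local Notation H := (quaternion R).
Hypothesis uI : imag_units I.
Local Notation L := (complex_line I).
Local Notation pt x y := (slice_pt I (x, y)).
Implicit Types (p q A : H) (k u v : H -> H) (a b c d x y : R).

Definition in_rect a b c d x y := (a <= x <= b) && (c <= y <= d).

Definition on_edge a b c d x y :=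
  in_rect a b c d x y /\ [\/ x = a, x = b, y = c | y = d].

Definition edge_cont a b c d k :=
  [/\ cont_on c d (fun y => k (pt b y)), cont_on c d (fun y => k (pt a y)),
      cont_on a b (fun x => k (pt x d)) & cont_on a b (fun x => k (pt x c))].

(* [I * bint a b c d k] is the integral of [dq k] along the positively oriented
   boundary of [a, b] x [c, d]. *)
Definition bint a b c d k : H :=
  qint c d (fun y => k (pt b y)) - qint c d (fun y => k (pt a y))
  + I * (qint a b (fun x => k (pt x d)) - qint a b (fun x => k (pt x c))).

Lemma pt_dist x y x' y' : `|pt x' y' - pt x y| <= `|x' - x| + `|y' - y|.
Proof. by rewrite -slice_ptB; exact: norm_slice_pt_le. Qed.

Lemma hol_cont_on_x k a b y : (forall x, a <= x <= b -> hol I k (pt x y)) ->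
  cont_on a b (fun x => k (pt x y)).
Proof.
move=> hk x xab; apply/cvgrPdist_lt => e e0.
have [d d0 kd] := hol_cont (hk x xab) e0.
exists d => //= z xz; rewrite distrC; apply: kd; first exact: line_pt.
by apply: le_lt_trans (pt_dist _ _ _ _) _; rewrite subrr normr0 addr0 distrC.
Qed.

Lemma hol_cont_on_y k x c d : (forall y, c <= y <= d -> hol I k (pt x y)) ->
  cont_on c d (fun y => k (pt x y)).
Proof.
move=> hk y ycd; apply/cvgrPdist_lt => e e0.
have [r r0 kr] := hol_cont (hk y ycd) e0.
exists r => //= z yz; rewrite distrC; apply: kr; first exact: line_pt.
by apply: le_lt_trans (pt_dist _ _ _ _) _; rewrite subrr normr0 add0r distrC.
Qed.

Lemma hol_edge_cont a b c d k : a <= b -> c <= d ->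
  (forall x y, on_edge a b c d x y -> hol I k (pt x y)) -> edge_cont a b c d k.
Proof.
move=> ab cd hk; split.
- apply: hol_cont_on_y => y ycd; apply: hk; split; last by constructor 2.
  by rewrite /in_rect ab lexx ycd.
- apply: hol_cont_on_y => y ycd; apply: hk; split; last by constructor 1.
  by rewrite /in_rect ab lexx ycd.
- apply: hol_cont_on_x => y ycd; apply: hk; split; last by constructor 4.
  by rewrite /in_rect cd lexx ycd.
- apply: hol_cont_on_x => y ycd; apply: hk; split; last by constructor 3.
  by rewrite /in_rect cd lexx ycd.
Qed.

Lemma eq_bint a b c d k l : a <= b -> c <= d ->
  (forall x y, on_edge a b c d x y -> k (pt x y) = l (pt x y)) ->
  bint a b c d k = bint a b c d l.
Proof.
move=> ab cd kl; rewrite /bint; congr (_ - _ + I * (_ - _));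
  apply: eq_qint => x xab;
  apply: kl; split; rewrite /in_rect ?lexx ?ab ?cd ?xab//.
- by constructor 2.
- by constructor 1.
- by constructor 4.
- by constructor 3.
Qed.

Lemma edge_cont_mull a b c d k q : edge_cont a b c d k ->
  edge_cont a b c d (fun r => q * k r).
Proof. by move=> [k1 k2 k3 k4]; split; exact: cont_on_mull. Qed.

Lemma edge_cont_mulr a b c d k q : edge_cont a b c d k ->
  edge_cont a b c d (fun r => k r * q).
Proof. by move=> [k1 k2 k3 k4]; split; exact: cont_on_mulr. Qed.

Lemma bintD a b c d k l : edge_cont a b c d k -> edge_cont a b c d l ->
  bint a b c d (fun q => k q + l q) = bint a b c d k + bint a b c d l.
Proof.
move=> [k1 k2 k3 k4] [l1 l2 l3 l4]; rewrite /bint !qintD//.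
do 4 move: (qint _ _ _) (qint _ _ _) => ? ?.
by rewrite !mulrBr !mulrDr; apply: quat_ext => /=; ring.
Qed.

(** A left factor has to pass the [I] in [bint], hence the condition [L q]; a right factor meets no
    such obstacle. *)
Lemma bint_mull a b c d k q : L q -> edge_cont a b c d k ->
  bint a b c d (fun r => q * k r) = q * bint a b c d k.
Proof.
move=> Lq [k1 k2 k3 k4]; rewrite /bint !qint_mull//.
do 4 move: (qint _ _ _) => ?; rewrite -!mulrBr [RHS]mulrDr; congr (_ + _).
by rewrite !mulrA (line_comm uI Lq (line_unit uI)).
Qed.

Lemma bint_mulr a b c d k q : edge_cont a b c d k ->
  bint a b c d (fun r => k r * q) = bint a b c d k * q.
Proof.
move=> [k1 k2 k3 k4]; rewrite /bint !qint_mulr//.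
by do 4 move: (qint _ _ _) => ?; rewrite -!mulrBl [RHS]mulrDl mulrA.
Qed.

Lemma bintB a b c d k l : edge_cont a b c d k -> edge_cont a b c d l ->
  bint a b c d (fun q => k q - l q) = bint a b c d k - bint a b c d l.
Proof.
move=> ck cl; rewrite -[in RHS]mulrN1 -bint_mulr// -bintD//.
  by congr bint; apply/funext => q; rewrite mulrN1.
exact: edge_cont_mulr.
Qed.

Lemma bint_le a b c d k (M : R) : a <= b -> c <= d -> edge_cont a b c d k ->
  (forall x y, on_edge a b c d x y -> `|k (pt x y)| <= M) ->
  `|bint a b c d k| <= 8 * M * ((b - a) + (d - c)).
Proof.
move=> ab cd [k1 k2 k3 k4] kM.
have h1 : `|qint c d (fun y => k (pt b y))| <= 4 * M * (d - c).
  apply: qint_norm_le => // x xab; apply: kM; split; last by constructor 2.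
  by rewrite /in_rect ab lexx xab.
have h2 : `|qint c d (fun y => k (pt a y))| <= 4 * M * (d - c).
  apply: qint_norm_le => // x xab; apply: kM; split; last by constructor 1.
  by rewrite /in_rect ab lexx xab.
have h3 : `|qint a b (fun x => k (pt x d))| <= 4 * M * (b - a).
  apply: qint_norm_le => // x xab; apply: kM; split; last by constructor 4.
  by rewrite /in_rect cd lexx xab.
have h4 : `|qint a b (fun x => k (pt x c))| <= 4 * M * (b - a).
  apply: qint_norm_le => // x xab; apply: kM; split; last by constructor 3.
  by rewrite /in_rect cd lexx xab.
have [_ I1] := (imag_unitsP I).1 uI.
have -> : 8 * M * ((b - a) + (d - c)) =
  (4 * M * (d - c) + 4 * M * (d - c)) + (4 * M * (b - a) + 4 * M * (b - a)) by
    ring.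
apply: le_trans (ler_normD _ _) _; apply: lerD.
  by apply: le_trans (ler_normB _ _) _; apply: lerD.
rewrite quat_normM I1 mul1r.
by apply: le_trans (ler_normB _ _) _; apply: lerD.
Qed.

Lemma edge_cont_hol a b c d k : a <= b -> c <= d -> (forall p, L p ->
  hol I k p) ->
  edge_cont a b c d k.
Proof. by move=> ab cd hk; apply: hol_edge_cont => // x y _; apply/hk/line_pt.
Qed.

(** For the identity, opposite vertical edges differ by the constant [b - a] and opposite horizontal
    ones by [(d - c) *: I]. The two contributions are equal up to the factor [I * I = -1] and
    cancel. *)
Lemma bint_affine a b c d q A : a <= b -> c <= d ->
  bint a b c d (fun r => q + r * A) = 0.
Proof.
move=> ab cd.
have ec : edge_cont a b c d (fun r => r * A).
  by apply: edge_cont_hol => // p _; apply: hol_mulr; exact: hol_id.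
have e0 : edge_cont a b c d (fun=> q).
  by apply: edge_cont_hol => // p _; exact: hol_cst.
rewrite bintD// bint_mulr; last by apply: edge_cont_hol => // p _;
  exact: hol_id.
rewrite {1}/bint !subrr mulr0 !add0r.
have e1 : edge_cont a b c d id by apply: edge_cont_hol => // p _; exact: hol_id.
case: e1 => /= k1 k2 k3 k4.
have -> : bint a b c d id = 0; last by rewrite mul0r.
rewrite /bint -[- qint c d _]mulN1r -[- qint a b _]mulN1r -!qint_mull//.
rewrite -!qintD//; try exact: cont_on_mull.
rewrite (@eq_qint _ c d _ (fun=> (b - a)%:A)); last first.
  by move=> y _; rewrite !slice_ptE//; apply: quat_ext => /=; ring.
rewrite (@eq_qint _ a b _ (fun=> (d - c) *: I)); last first.
  have [I0 _] := (imag_unitsP I).1 uI.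
  by move=> y _; rewrite !slice_ptE//; apply: quat_ext => /=; rewrite ?I0; ring.
rewrite !qint_cst// -!scalerAr -expr2 [I ^+ 2]uI !scalerA.
by apply: quat_ext => /=; ring.
Qed.

Lemma bint_splitx a m b c d k : a <= m -> m <= b -> edge_cont a b c d k ->
  bint a b c d k = bint a m c d k + bint m b c d k.
Proof.
move=> am mb [k1 k2 k3 k4]; rewrite /bint (qint_split am mb k3) (qint_split am
  mb k4).
do 3 move: (qint _ _ _) (qint _ _ _) => ? ?.
by rewrite !mulrBr !mulrDr; apply: quat_ext => /=; ring.
Qed.

Lemma bint_splity a b c m d k : c <= m -> m <= d -> edge_cont a b c d k ->
  bint a b c d k = bint a b c m k + bint a b m d k.
Proof.
move=> am mb [k1 k2 k3 k4]; rewrite /bint (qint_split am mb k1) (qint_split am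
  mb k2).
do 3 move: (qint _ _ _) (qint _ _ _) => ? ?.
by rewrite !mulrBr; apply: quat_ext => /=; ring.
Qed.

Definition hol_rect a b c d k :=
  forall x y, in_rect a b c d x y -> hol I k (pt x y).

Lemma hol_rect_edge a b c d k : a <= b -> c <= d -> hol_rect a b c d k ->
  edge_cont a b c d k.
Proof. by move=> ab cd hk; apply: hol_edge_cont => // x y [/hk]. Qed.

Lemma hol_rectS a b c d a' b' c' d' k : a <= a' -> b' <= b -> c <= c' ->
  d' <= d ->
  hol_rect a b c d k -> hol_rect a' b' c' d' k.
Proof.
move=> aa bb cc dd hk x y /andP[/andP[ax xb] /andP[cy yd]]; apply: hk.
by rewrite /in_rect (le_trans aa) ?(le_trans xb) ?(le_trans cc) ?(le_trans yd).
Qed.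

(* The bound is quadratic in the half-perimeter, so it splits evenly among the
   four quarters and has to fail on one of them. *)
Lemma bint_quarter a b c d k (e : R) : a <= b -> c <= d -> hol_rect a b c d k ->
  e * ((b - a) + (d - c)) ^+ 2 < `|bint a b c d k| ->
  exists a' b' c' d', [/\ [/\ a <= a', a' <= b' & b' <= b],
    [/\ c <= c', c' <= d' & d' <= d],
    (b' - a') + (d' - c') = ((b - a) + (d - c)) / 2 &
    e * ((b' - a') + (d' - c')) ^+ 2 < `|bint a' b' c' d' k|].
Proof.
move=> ab cd hk big; pose m := (a + b) / 2; pose n := (c + d) / 2.
have am : a <= m by rewrite /m; lra.
have mb : m <= b by rewrite /m; lra.
have cn : c <= n by rewrite /n; lra.
have nd : n <= d by rewrite /n; lra.
have split4 : bint a b c d k = (bint a m c n k + bint a m n d k)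
    + (bint m b c n k + bint m b n d k).
  rewrite (bint_splitx am mb); last exact: hol_rect_edge.
  by rewrite !(bint_splity cn nd)//; apply: hol_rect_edge => //;
    exact: hol_rectS hk.
set D := (b - a) + (d - c) in big *.
have D1 : (m - a) + (n - c) = D / 2 by rewrite /m /n /D; field.
have D2 : (m - a) + (d - n) = D / 2 by rewrite /m /n /D; field.
have D3 : (b - m) + (n - c) = D / 2 by rewrite /m /n /D; field.
have D4 : (b - m) + (d - n) = D / 2 by rewrite /m /n /D; field.
set B := e * (D / 2) ^+ 2.
have BE : e * D ^+ 2 = (B + B) + (B + B) by rewrite /B; field.
have [h1|h1] := ltP B `|bint a m c n k|.
  by exists a, m, c, n; rewrite D1.
have [h2|h2] := ltP B `|bint a m n d k|.
  by exists a, m, n, d; rewrite D2.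
have [h3|h3] := ltP B `|bint m b c n k|.
  by exists m, b, c, n; rewrite D3.
have [h4|h4] := ltP B `|bint m b n d k|.
  by exists m, b, n, d; rewrite D4.
exfalso; move: big; rewrite BE split4 ltNge => /negP; apply.
apply: le_trans (ler_normD _ _) _; apply: lerD;
  by apply: le_trans (ler_normD _ _) _; apply: lerD.
Qed.

End Rectangles.

(** * Goursat's theorem, deformation of rectangles and removable singularities *)

Section Cauchy.
Variables (R : realType) (I : quaternion R).
Local Notation H := (quaternion R).
Hypothesis uI : imag_units I.
Local Notation L := (complex_line I).
Local Notation pt x y := (slice_pt I (x, y)).
Implicit Types (p q z A : H) (k u v g : H -> H) (a b c d x y r : R).

Lemma ltr_pow2 (D e : R) : 0 < e -> exists n : nat, D / 2 ^+ n < e.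
Proof.
move=> e0; have [n Dn] : exists n : nat, D / e < n%:R.
  exists (Num.truncn (D / e)).+1; exact: truncnS_gt.
exists n; rewrite ltr_pdivrMr ?exprn_gt0// mulrC -ltr_pdivrMr//.
by apply: lt_trans Dn _; rewrite -natrX ltr_nat ltn_expl.
Qed.

(** If the bound failed, it would fail on nested rectangles shrinking to a point. Near that point
    [k] is affine up to a small error, and the affine part has integral 0, so the bound holds on a
    small enough rectangle. *)
Lemma bint_goursat_le a b c d k (e : R) : a <= b -> c <= d ->
  hol_rect I a b c d k -> 0 < e ->
  `|bint I a b c d k| <= e * ((b - a) + (d - c)) ^+ 2.
Proof.
move=> ab cd hk e0; rewrite leNgt; apply/negP => big.
pose T : Type := (R * R * R * R)%type.
pose D (s : T) := (s.1.1.2 - s.1.1.1) + (s.2 - s.1.2).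
pose P (s : T) := [/\ s.1.1.1 <= s.1.1.2, s.1.2 <= s.2,
  hol_rect I s.1.1.1 s.1.1.2 s.1.2 s.2 k &
  e * D s ^+ 2 < `|bint I s.1.1.1 s.1.1.2 s.1.2 s.2 k|].
pose sub (t s : T) := [/\ s.1.1.1 <= t.1.1.1, t.1.1.2 <= s.1.1.2,
  s.1.2 <= t.1.2 & t.2 <= s.2].
(* The premise [P s] is inside the existential so that [next] is total; quadruples violating [P] are
   sent to themselves. *)
have /choice[next nextP] : forall s, exists s', P s ->
    [/\ P s', sub s' s & D s' = D s / 2].
  move=> s; have [Ps|nPs] := pselect (P s); last by exists s.
  have [ss1 ss2 hs bs] := Ps.
  have [a' [b' [c' [d' [[h1 h2 h3] [h4 h5 h6] h7 h8]]]]] :=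
    bint_quarter uI ss1 ss2 hs bs.
  exists (a', b', c', d') => _; split => //; split => //=.
  exact: hol_rectS hs.
pose s n := iter n next (a, b, c, d).
have Ps n : P (s n).
  by elim: n => [//|n IH]; have [] := nextP _ IH.
have subs m n : (m <= n)%N -> sub (s n) (s m).
  move=> /subnK <-; elim: (n - m)%N => [|i [h1 h2 h3 h4]].
    by rewrite add0n; split.
  have [_ [h5 h6 h7 h8] _] := nextP _ (Ps (i + m)%N).
  by rewrite addSn; split; [exact: le_trans h5|exact: le_trans h2
    |exact: le_trans h7|exact: le_trans h4].
have Dn n : D (s n) = D (a, b, c, d) / 2 ^+ n.
  elim: n => [|n IH]; first by rewrite expr0 divr1.
  by have [_ _ ->] := nextP _ (Ps n); rewrite IH exprS invfM; ring.
have ubl m n : (s m).1.1.1 <= (s n).1.1.2.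
  have [h1 _ _ _] := Ps (maxn m n).
  have [h2 _ _ _] := subs m _ (leq_maxl m n).
  have [_ h3 _ _] := subs n _ (leq_maxr m n).
  exact: le_trans h2 (le_trans h1 h3).
have ubr m n : (s m).1.2 <= (s n).2.
  have [_ h1 _ _] := Ps (maxn m n).
  have [_ _ h2 _] := subs m _ (leq_maxl m n).
  have [_ _ _ h3] := subs n _ (leq_maxr m n).
  exact: le_trans h2 (le_trans h1 h3).
(* Every lower endpoint is below every upper one, so the suprema of the lower endpoints give a point
   common to all rectangles. *)
pose x := sup (range (fun n => (s n).1.1.1)).
pose y := sup (range (fun n => (s n).1.2)).
have xs n : (s n).1.1.1 <= x <= (s n).1.1.2.
  apply/andP; split.
    apply: ub_le_sup; last by exists n.
    by exists (s 0%N).1.1.2 => _ [m _ <-].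
  apply: ge_sup; first by exists (s 0%N).1.1.1, 0%N.
  by move=> _ [m _ <-].
have ys n : (s n).1.2 <= y <= (s n).2.
  apply/andP; split.
    apply: ub_le_sup; last by exists n.
    by exists (s 0%N).2 => _ [m _ <-].
  apply: ge_sup; first by exists (s 0%N).1.2, 0%N.
  by move=> _ [m _ <-].
have [A kA] : hol I k (pt x y).
  by apply: hk; have := xs 0%N; have := ys 0%N; rewrite /in_rect => /= -> ->.
(* [bint_le] costs a factor 8; distances to the common point are at most the half-perimeter [t], so
   precision [e / 8] yields [e * t^2]. *)
have e8 : 0 < e / 8 by rewrite divr_gt0.
have [r r0 kr] := kA _ e8.
have [n nr] := ltr_pow2 (D (a, b, c, d)) r0.
rewrite -Dn in nr.
have [h1 h2 h3 h4] := Ps n.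
have := xs n; have := ys n; move: nr h1 h2 h3 h4;
  move: (s n) => [[[a' b'] c'] d'].
rewrite /D /= => nr ab' cd' hk' big' /andP[cy yd] /andP[ax xb].
set t := _ + _ in nr big'.
pose l q := (k (pt x y) - pt x y * A) + q * A.
have hl q : hol I l q.
  by apply: hol_add; [exact: hol_cst|apply: hol_mulr; exact: hol_id].
have ec : edge_cont I a' b' c' d' (fun q => k q - l q).
  by apply: hol_rect_edge => // u v uv; apply: hol_sub => //; exact: hk'.
have kE : k = (fun q => l q + (k q - l q)) by apply/funext => q;
  rewrite addrC subrK.
move: big'; rewrite ltNge => /negP; apply; rewrite kE bintD//; last first.
  by apply: edge_cont_hol.
rewrite bint_affine// add0r.
have -> : e * t ^+ 2 = 8 * (e / 8 * t) * ((b' - a') + (d' - c')).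
  by rewrite /t; field.
apply: bint_le => // u v [/andP[/andP[au ub] /andP[cv vd]] _].
have dist : `|pt u v - pt x y| <= t.
  by apply: le_trans (pt_dist uI _ _ _ _) _; rewrite lerD// ler_norml;
    apply/andP; split; lra.
rewrite /l; have -> : k (pt u v) - (k (pt x y) - pt x y * A + pt u v * A) =
  k (pt u v) - k (pt x y) - (pt u v - pt x y) * A.
  by rewrite mulrBl; move: (_ * A) (_ * A) => ? ?; apply: quat_ext => /=; ring.
apply: le_trans (kr _ (line_pt _ _) (le_lt_trans dist nr)) _.
by rewrite ler_wpM2l// ltW.
Qed.

Theorem bint_goursat a b c d k : a <= b -> c <= d ->
  hol_rect I a b c d k -> bint I a b c d k = 0.
Proof.
move=> ab cd hk; apply/eqP; rewrite -normr_eq0 eq_le normr_ge0 andbT.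
apply/ler_addgt0Pl => e e0; rewrite addr0.
set D := (b - a) + (d - c).
have D1 : 0 < D ^+ 2 + 1 by rewrite ltr_wpDl// sqr_ge0.
apply: le_trans (bint_goursat_le ab cd hk (divr_gt0 e0 D1)) _.
rewrite -/D -mulrA ler_piMr// ?(ltW e0)// mulrC ler_pdivrMr// mul1r; lra.
Qed.

(** The frame between the rectangles is cut into two strips of full height, left and right, and two
    pieces below and above the inner rectangle. Goursat's theorem applies to each, so nothing is
    required of [k] in the interior of the inner rectangle. *)
Lemma bint_shrink a b c d a' b' c' d' k :
  a <= a' -> a' <= b' -> b' <= b -> c <= c' -> c' <= d' -> d' <= d ->
  (forall x y, in_rect a b c d x y ->
    [\/ x <= a', b' <= x, y <= c' | d' <= y] ->
    hol I k (pt x y)) ->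
  bint I a b c d k = bint I a' b' c' d' k.
Proof.
move=> aa ab' bb cc cd' dd hk.
have ab : a <= b by rewrite (le_trans aa) ?(le_trans ab').
have cd : c <= d by rewrite (le_trans cc) ?(le_trans cd').
have a'b : a' <= b by exact: le_trans bb.
have c'd : c' <= d by exact: le_trans dd.
have W x y a1 b1 c1 d1 : a <= a1 -> b1 <= b -> c <= c1 -> d1 <= d ->
    in_rect a1 b1 c1 d1 x y -> in_rect a b c d x y.
  move=> h1 h2 h3 h4 /andP[/andP[ax xb] /andP[cy yd]]; rewrite /in_rect.
  by rewrite (le_trans h1) ?(le_trans xb) ?(le_trans h3) ?(le_trans yd).
rewrite (bint_splitx aa a'b); last first.
  apply: hol_edge_cont => // x y [xy h]; apply: hk => //.
  by case: h => ->; [constructor 1|constructor 2|constructor 3|constructor 4].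
rewrite (@bint_goursat a a')//; last first.
  move=> x y xy; apply: hk; first exact: W xy.
  by constructor 1; move: xy => /andP[/andP[]].
rewrite add0r (bint_splitx ab' bb); last first.
  apply: hol_edge_cont => // x y [xy h]; apply: hk => //; first exact: W xy.
  by case: h => ->; [constructor 1|constructor 2|constructor 3|constructor 4].
rewrite (@bint_goursat b' b)//; last first.
  move=> x y xy; apply: hk; first by apply: W xy => //; exact: le_trans ab'.
  by constructor 2; move: xy => /andP[/andP[]].
rewrite addr0 (bint_splity cc c'd); last first.
  apply: hol_edge_cont => // x y [xy h]; apply: hk => //; first exact: W xy.
  by case: h => ->; [constructor 1|constructor 2|constructor 3|constructor 4].
rewrite (@bint_goursat a' b' c c')//; last first.
  move=> x y xy; apply: hk; first exact: W xy.
  by constructor 3; move: xy => /andP[_ /andP[]].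
rewrite add0r (bint_splity cd' dd); last first.
  apply: hol_edge_cont => // x y [xy h]; apply: hk => //; first exact: W xy.
  by case: h => ->; [constructor 1|constructor 2|constructor 3|constructor 4].
rewrite (@bint_goursat a' b' d' d)//; last first.
  move=> x y xy; apply: hk; first by apply: W xy => //; exact: le_trans cd'.
  by constructor 4; move: xy => /andP[_ /andP[]].
by rewrite addr0.
Qed.

(** The contour can be shrunk to a square around the exceptional point; [k] is bounded there, so the
    integral is at most a constant times the side. *)
Lemma bint_removable a b c d x y k (M r : R) : a < x < b -> c < y < d ->
  0 < r ->
  (forall x' y', in_rect a b c d x' y' -> (x', y') <> (x, y) ->
    hol I k (pt x' y')) ->
  (forall q, L q -> `|q - pt x y| < r -> q != pt x y -> `|k q| <= M) ->
  bint I a b c d k = 0.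
Proof.
move=> /andP[ax xb] /andP[cy yd] r0 hk kM.
apply/eqP; rewrite -normr_eq0 eq_le normr_ge0 andbT.
apply/ler_addgt0Pl => e e0; rewrite addr0.
have M1 : 0 < `|M| + 1 by rewrite ltr_wpDl.
(* [f] is the half-side of the small square. Its points are within [2 * f < r] of the centre, and
   [32 = 8 * 4]: the factor of [bint_le] times the half-perimeter [4 * f]. *)
pose f := Num.min (Num.min (Num.min (x - a) (b - x)) (Num.min (y - c) (d - y)))
  (Num.min (r / 3) (e / (32 * (`|M| + 1)))).
have f0 : 0 < f by rewrite !lt_min !subr_gt0 ax xb cy yd !divr_gt0// mulr_gt0.
have : f <= f by [].
rewrite {2}/f !le_min => /andP[/andP[/andP[f1 f2] /andP[f3 f4]] /andP[f5 f6]].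
have ne x' y' : [\/ x' <= x - f, x + f <= x', y' <= y - f | y + f <= y'] ->
    (x', y') <> (x, y).
  by move=> h [xx yy]; subst; case: h; lra.
rewrite (@bint_shrink a b c d (x - f) (x + f) (y - f) (y + f)); try lra;
  last first.
  by move=> x' y' xy h; apply: hk => //; exact: ne.
have hk' x' y' : on_edge (x - f) (x + f) (y - f) (y + f) x' y' ->
    hol I k (pt x' y').
  move=> [/andP[/andP[h1 h2] /andP[h3 h4]] h]; apply: hk.
    by rewrite /in_rect; apply/andP; split; apply/andP; split; lra.
  by apply: ne; case: h => ->; [constructor 1|constructor 2|constructor
    3|constructor 4].
have fe : 8 * (`|M| + 1) * ((x + f - (x - f)) + (y + f - (y - f))) <= e.
  rewrite ler_pdivlMr in f6; last by rewrite mulr_gt0.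
  by apply: le_trans f6; rewrite le_eqVlt; apply/orP; left; apply/eqP; ring.
apply: le_trans fe; apply: (bint_le uI); try lra.
  by apply: (hol_edge_cont uI) => //; lra.
move=> x' y' [/andP[/andP[h1 h2] /andP[h3 h4]] h].
have := ler_norm M => MM.
apply: (@le_trans _ _ M); last by lra.
apply: kM; first exact: line_pt.
  apply: le_lt_trans (pt_dist uI _ _ _ _) _.
  have : `|x' - x| <= f by rewrite ler_norml; apply/andP; split; lra.
  have : `|y' - y| <= f by rewrite ler_norml; apply/andP; split; lra.
  lra.
apply/eqP => e1; have := congr1 (fun q => `|q - pt x y|) e1.
rewrite subrr normr0 -slice_ptB => n0.
have := ge_slice_pt1 uI ((x', y') - (x, y));
  have := ge_slice_pt2 uI ((x', y') - (x, y)).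
rewrite n0 !normr_le0 /= !subr_eq0 => /eqP yy /eqP xx.
by apply: (ne x' y'); [case: h => ->;
  [constructor 1|constructor 2|constructor 3|constructor 4]
  |rewrite xx yy].
Qed.

End Cauchy.

(** * Cauchy expansion *)

Section Taylor.
Variables (R : realType) (I : quaternion R).
Local Notation H := (quaternion R).
Hypothesis uI : imag_units I.
Local Notation L := (complex_line I).
Local Notation pt x y := (slice_pt I (x, y)).
Implicit Types (p q z A : H) (k u v g : H -> H) (a b c d x y r : R).

Lemma hol_invX n p : L p -> p != 0 -> hol I (fun q => q^-1 ^+ n) p.
Proof.
move=> Lp p0; elim: n => [|n IH]; first exact: hol_cst.
have -> : (fun q => q^-1 ^+ n.+1) = (fun q => (q - 0)^-1 * q^-1 ^+ n).
  by apply/funext => q; rewrite subr0 exprS.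
apply: hol_mul => //; last exact: hol_inv (line0 _) _ _.
by rewrite subr0; exact: lineV.
Qed.

Lemma rint_ge a b (u : R -> R) (m : R) : a <= b -> cont_on a b u ->
  (forall x, a <= x <= b -> m <= u x) -> (b - a) * m <= rint a b u.
Proof.
move=> ab cu mu; rewrite -rint_cst// /rint; apply: le_Rintegral => //.
- by apply: cont_on_integrable => x _; exact: cvg_cst.
- exact: cont_on_integrable.
Qed.

Lemma inv_pt x y : (pt x y)^-1 = (x ^+ 2 + y ^+ 2)^-1 *: pt x (- y).
Proof.
have [I0 _] := (imag_unitsP I).1 uI.
have e : quat_norm2 (pt x y) = x ^+ 2 + y ^+ 2.
  by rewrite -sqr_normq norm_slice_pt// sqr_sqrtr// addr_ge0 ?sqr_ge0.
have -> : (pt x y)^-1 = quat_inv (pt x y) by [].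
rewrite /quat_inv e; congr (_ *: _); rewrite !slice_ptE//.
by apply: quat_ext => /=; ring.
Qed.

Local Notation B r := (bint I (- r) r (- r) r).

Let le_oppr r : 0 < r -> - r <= r. Proof. by move=> ?; lra. Qed.

Lemma edge_norm_ge s x y : on_edge (- s) s (- s) s x y -> s <= `|pt x y|.
Proof.
move=> [_ h]; have := ge_slice_pt1 uI (x, y);
  have := ge_slice_pt2 uI (x, y) => /=.
move: h; have := ler_norm x; have := ler_norm y; have := ler_norm (- x).
by have := ler_norm (- y); rewrite !normrN => ? ? ? ? [] ? ? ?; lra.
Qed.

Lemma edge_neq0 s x y : 0 < s -> on_edge (- s) s (- s) s x y -> pt x y != 0.
Proof. by move=> s0 /edge_norm_ge h; rewrite -normr_gt0 (lt_le_trans s0). Qed.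

Lemma edge_cont_invX r n : 0 < r ->
  edge_cont I (- r) r (- r) r (fun q => q^-1 ^+ n).
Proof.
move=> r0; apply: hol_edge_cont => [|||x y h]; rewrite ?le_oppr//.
by apply: hol_invX; [exact: line_pt|exact: edge_neq0 h].
Qed.

(** Both pairs of opposite edges contribute the integral of the same positive real function [w]. The
    value [m] is 2 pi, but only its being real and positive is used. *)
Lemma bint_inv r : 0 < r -> exists2 m : R, 0 < m & B r (fun q => q^-1) = m%:A.
Proof.
move=> r0; have rr := le_oppr r0; have [I0 _] := (imag_unitsP I).1 uI.
have [k1 k2 k3 k4] : edge_cont I (- r) r (- r) r (fun q => q^-1).
  exact: (edge_cont_invX 1 r0).
pose w x : H := (2 * r / (r ^+ 2 + x ^+ 2))%:A.
have n0 x : r ^+ 2 + x ^+ 2 != 0.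
  by rewrite gt_eqF// ltr_wpDr ?sqr_ge0// exprn_gt0.
have e1 x : (pt r x)^-1 + -1 * (pt (- r) x)^-1 = w x.
  rewrite !inv_pt !slice_ptE// sqrrN /w.
  by apply: quat_ext => /=; rewrite ?I0; field; rewrite n0.
have e2 x : I * (pt x r)^-1 + - I * (pt x (- r))^-1 = w x.
  rewrite !inv_pt sqrrN opprK [x ^+ 2 + _]addrC /w mulNr -mulrBr -scalerBr.
  have -> : pt x (- r) - pt x r = (- 2 * r) *: I.
    by rewrite !slice_ptE//; apply: quat_ext => /=; rewrite ?I0; ring.
  rewrite -!scalerAr -expr2 [I ^+ 2]uI.
  by apply: quat_ext => /=; field; rewrite n0.
have cw : cont_on (- r) r w.
  have -> : w = (fun x => (pt r x)^-1 + -1 * (pt (- r) x)^-1).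
    by apply/funext => x; rewrite e1.
  have c2 := cont_on_mull (q := -1) k2.
  by move=> x xr; apply: cvgD; [exact: k1|exact: (c2 x xr)].
have BE : B r (fun q => q^-1) = qint (- r) r w + qint (- r) r w.
  rewrite /bint mulrBr -[- qint _ _ _]mulN1r -[- (I * qint _ _ _)]mulNr.
  rewrite -!qint_mull//; congr (_ + _).
    rewrite -qintD//; last exact: cont_on_mull.
    by congr qint; apply/funext => x; rewrite e1.
  rewrite -qintD; [|exact: cont_on_mull..].
  by congr qint; apply/funext => x; rewrite e2.
have [w1 w2 w3 w4] := cont_on_parts cw.
exists (rint (- r) r (@qre R \o w) + rint (- r) r (@qre R \o w)).
  (* On the edge [r^2 + x^2 <= 2 * r^2], so [w] is at least [r^-1]. *)
  have : (r - - r) * r^-1 <= rint (- r) r (@qre R \o w).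
    apply: rint_ge => // x /andP[x1 x2]; rewrite /w /= mulr1.
    rewrite -[r^-1]mul1r ler_pdivrMr// mulrAC ler_pdivlMr; last first.
      by rewrite lt_def n0 addr_ge0 ?sqr_ge0.
    by rewrite mul1r !expr2; nra.
  by rewrite opprK mulrDl divff ?gt_eqF//; lra.
have z0 : rint (- r) r (fun=> 0) = 0 by rewrite rint_cst// mulr0.
have zz (u : R -> R) : (forall x, u x = 0) -> rint (- r) r u = 0.
  by move=> u0; rewrite -z0; congr rint; apply/funext.
rewrite BE; apply: quat_ext; rewrite /= ?mulr1 ?mulr0//;
  by rewrite zz ?addr0// => x; rewrite /w /= mulr0.
Qed.

(* Enlarging the square to one of half-side T does not change the integral,
   which is O(1/T). *)
Lemma bint_invX r n : 0 < r -> B r (fun q => q^-1 ^+ n.+2) = 0.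
Proof.
move=> r0; apply/eqP; rewrite -normr_eq0 eq_le normr_ge0 andbT.
apply/ler_addgt0Pl => e e0; rewrite addr0.
(* The bound on the large square is [8 * T^-2 * 4 * T = 32 / T]; [T >= 1] lets the exponent [n.+2]
   be lowered to 2. *)
pose T := r + 1 + 32 / e.
have e32 : 0 < 32 / e by rewrite divr_gt0.
have T1 : 1 <= T by rewrite /T; lra.
have rT : r <= T by rewrite /T; lra.
have T0 : 0 < T by lra.
rewrite -(@bint_shrink _ _ uI (- T) T (- T) T); try lra; last first.
  move=> x y _ h; apply: hol_invX; first exact: line_pt.
  rewrite -normr_gt0; apply: lt_le_trans r0 _.
  have := ge_slice_pt1 uI (x, y); have := ge_slice_pt2 uI (x, y) => /=.
  have := ler_norm x; have := ler_norm y; have := ler_norm (- x).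
  by have := ler_norm (- y); rewrite !normrN; case: h => *; lra.
apply: (@le_trans _ _ (8 * (T^-1 ^+ 2) * ((T - - T) + (T - - T)))).
  apply: (bint_le uI); try lra.
    apply: (hol_edge_cont uI); try lra.
    move=> x y h; apply: hol_invX; first exact: line_pt.
    exact: edge_neq0 h.
  move=> x y h; have n0 := edge_neq0 T0 h; have nT := edge_norm_ge h.
  rewrite quat_normX quat_normV//.
  have iT : `|pt x y|^-1 <= T^-1 by rewrite lef_pV2 ?posrE ?normr_gt0.
  apply: (@le_trans _ _ (T^-1 ^+ n.+2)).
    by apply: lerXn2r; rewrite ?nnegrE ?invr_ge0 ?normr_ge0// ltW.
  by apply: ler_wiXn2l; rewrite ?invr_ge0 ?invf_le1// ltW.
have -> : 8 * T^-1 ^+ 2 * (T - - T + (T - - T)) = 32 / T by field;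
  rewrite gt_eqF.
by rewrite ler_pdivrMr// mulrC -ler_pdivrMr// /T; lra.
Qed.

Lemma edge_bounded r k : 0 < r -> edge_cont I (- r) r (- r) r k ->
  exists2 M : R, 0 <= M &
  forall x y, on_edge (- r) r (- r) r x y -> `|k (pt x y)| <= M.
Proof.
move=> r0 [k1 k2 k3 k4]; have rr := le_oppr r0.
have [M1 M10 h1] := cont_on_bounded rr k1;
  have [M2 M20 h2] := cont_on_bounded rr k2.
have [M3 M30 h3] := cont_on_bounded rr k3;
  have [M4 M40 h4] := cont_on_bounded rr k4.
exists (M1 + M2 + M3 + M4); first by rewrite !addr_ge0.
move=> x y [/andP[xr yr] h]; case: h => e; subst.
- by apply: le_trans (h2 _ yr) _; lra.
- by apply: le_trans (h1 _ yr) _; lra.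
- by apply: le_trans (h4 _ xr) _; lra.
- by apply: le_trans (h3 _ xr) _; lra.
Qed.

(** The bound is asked at successors only, since the closed forms of partial sums used here are for
    nonempty sums. *)
Lemma cvg_normr0 (V : normedModType R) (u : nat -> V) (l : V) (c : nat -> R) :
  (forall n, `|u n.+1 - l| <= c n.+1) -> c @ \oo --> (0 : R) -> u @ \oo --> l.
Proof.
move=> uc c0; apply/cvgrPdist_le => e e0.
have /cvgrPdist_le/(_ e e0)[N _ hN] := c0.
exists N.+1 => // n /=; case: n => // n; rewrite ltnS => Nn.
rewrite distrC; apply: le_trans (uc n) _.
have := hN n.+1 (leqW Nn); rewrite sub0r normrN; exact: le_trans (ler_norm _).
Qed.

(** The difference quotient [k] at [z] has integral 0. Its moments [e n] against [q^-1 ^+ n] link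
    consecutive coefficients, so the partial sums telescope to [g z] minus a remainder that decays
    like [(|z| / r)^n]. *)
Theorem hol_series r g : 0 < r -> hol_rect I (- r) r (- r) r g ->
  exists b : nat -> H, forall z, L z -> `|z| < r ->
    series (fun n => z ^+ n * b n) @ \oo --> g z.
Proof.
move=> r0 hg; have rr := le_oppr r0; have [m m0 mE] := bint_inv r0.
(* The usual Cauchy coefficients, with [m] in the role of 2 pi. *)
exists (fun n => m^-1 *: B r (fun q => q^-1 ^+ n.+1 * g q)) => z Lz zr.
have [[x y] _ zE] := Lz.
have xr : - r < x < r.
  have := ge_slice_pt1 uI (x, y); rewrite zE /= => h.
  by rewrite -ltr_norml (le_lt_trans h).
have yr : - r < y < r.
  have := ge_slice_pt2 uI (x, y); rewrite zE /= => h.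
  by rewrite -ltr_norml (le_lt_trans h).
have hgz : hol I g z.
  rewrite -zE; apply: hg; rewrite /in_rect.
  by move: xr yr => /andP[/ltW -> /ltW ->] /andP[/ltW -> /ltW ->].
pose k q := (q - z)^-1 * (g q - g z).
have hk p : L p -> hol I g p -> p != z -> hol I k p.
  move=> Lp hgp pz; apply: hol_mul => //.
  - by apply/lineV/lineB.
  - exact: hol_inv.
  - by apply: hol_sub => //; exact: hol_cst.
(* The singularity of [k] at [z] is removable: the local Lipschitz constant of [g] at [z] bounds the
   quotient. *)
have Bk : B r k = 0.
  have [C [d [C0 d0 hC]]] := hol_lip hgz.
  apply: (bint_removable uI xr yr d0 (M := C)) => [x' y' xy' ne|q Lq qd qz].
    apply: hk; [exact: line_pt|exact: hg|].
    rewrite -zE; apply/eqP => e; apply: ne.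
    have := slice_ptB I (x', y') (x, y); rewrite e subrr => n0.
    have := ge_slice_pt1 uI ((x', y') - (x, y)).
    have := ge_slice_pt2 uI ((x', y') - (x, y)).
    by rewrite n0 normr0 !normr_le0 /= !subr_eq0 => /eqP -> /eqP ->.
  rewrite zE in qd qz *; have qz0 : q - z != 0 by rewrite subr_eq0.
  rewrite /k quat_normM quat_normV// mulrC ler_pdivrMr ?normr_gt0//.
  exact: hC.
have edgez x' y' : on_edge (- r) r (- r) r x' y' -> pt x' y' != z.
  move=> /edge_norm_ge h; apply: contraTneq zr => <-; by rewrite -leNgt.
have kc : edge_cont I (- r) r (- r) r k.
  apply: hol_edge_cont => // x' y' h; apply: hk;
    [exact: line_pt| |exact: edgez].
  by apply: hg; case: h.
have gc : edge_cont I (- r) r (- r) r g by exact: hol_rect_edge.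
have hX n l : (forall x y, on_edge (- r) r (- r) r x y -> hol I l (pt x y)) ->
    edge_cont I (- r) r (- r) r (fun q => q^-1 ^+ n * l q).
  move=> hl; apply: hol_edge_cont => // x' y' h; have n0 := edge_neq0 r0 h.
  apply: hol_mul => //; first exact: line_pt.
  - by apply/lineX/lineV/line_pt.
  - by apply: hol_invX => //; exact: line_pt.
  - exact: hl.
have hgE x' y' : on_edge (- r) r (- r) r x' y' -> hol I g (pt x' y').
  by move=> [h _]; exact: hg.
have hkE x' y' : on_edge (- r) r (- r) r x' y' -> hol I k (pt x' y').
  by move=> h; apply: hk; [exact: line_pt|exact: hgE|exact: edgez].
pose e n := B r (fun q => q^-1 ^+ n * k q).
(* This integrates [g q = (q - z) * k q + g z] against [q^-1 ^+ n.+1], using [q^-1 ^+ n.+1 * (q - z)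
   = q^-1 ^+ n - z * q^-1 ^+ n.+1]. *)
have step n : B r (fun q => q^-1 ^+ n.+1 * g q) - B r (fun q => q^-1 ^+ n.+1) *
  g z =
    e n - z * e n.+1.
  rewrite /e -bint_mulr; last exact: edge_cont_invX.
  rewrite -bint_mull//; last exact: hX.
  rewrite -!bintB; [|exact: hX|exact/edge_cont_mull/hX|exact: hX|].
  - apply: eq_bint => // x' y' h; have n0 := edge_neq0 r0 h.
    have qz : pt x' y' - z != 0 by rewrite subr_eq0; exact: edgez.
    set q := pt x' y' in n0 qz *.
    have -> : g q = (q - z) * k q + g z by rewrite /k mulrA divrr// mul1r subrK.
    have Lq : L q by exact: line_pt.
    have qE : q^-1 ^+ n.+1 * (q - z) = q^-1 ^+ n - z * q^-1 ^+ n.+1.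
      rewrite mulrBr {1}exprSr -(mulrA _ _ q) mulVr// mulr1; congr (_ - _).
      by apply: (line_comm uI) => //; apply/lineX/lineV.
    by rewrite mulrDr addrK mulrA qE mulrBl -(mulrA z).
  - by apply: edge_cont_mulr; exact: edge_cont_invX.
(* The term [g z] comes from index 0 alone, as the higher moments of the inverse vanish;
   [e 0 = B r k = 0] starts the telescoping. *)
have sumE n : \sum_(0 <= i < n.+1) z ^+ i * (m^-1 *: B r (fun q => q^-1 ^+ i.+1
  * g q)) =
    g z - m^-1 *: (z ^+ n.+1 * e n.+1).
  elim: n => [|n IH].
    have := step 0%N; rewrite big_nat1 expr0 mul1r expr1 mE.
    have -> : e 0%N = 0.
      by rewrite /e -Bk; congr bint; apply/funext => q; rewrite expr0 mul1r.
    rewrite sub0r => /eqP; rewrite subr_eq => /eqP ->.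
    rewrite scalerDr scalerN addrC; congr (_ - _).
    by rewrite -scalerAl mul1r scalerA mulVf ?gt_eqF// scale1r.
  rewrite big_nat_recr//= IH.
  have := step n.+1; rewrite (bint_invX n r0) mul0r subr0 => ->.
  rewrite -scalerAr mulrBr scalerBr mulrA -exprSr.
  by rewrite addrA subrK.
have [M M0 kM] := edge_bounded r0 kc.
apply: (cvg_normr0 (c := fun n => (m^-1 * (32 * M * r)) * (`|z| / r) ^+ n)) =>
  [n|].
  rewrite /series /= sumE addrAC subrr add0r normrN normrZ quat_normM
    quat_normX.
  rewrite ger0_norm ?invr_ge0 ?(ltW m0)// -mulrA ler_wpM2l ?invr_ge0 ?(ltW
    m0)//.
  have : `|e n.+1| <= 8 * (r^-1 ^+ n.+1 * M) * ((r - - r) + (r - - r)).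
    apply: bint_le => //; first exact: hX.
    move=> x' y' h; have n0 := edge_neq0 r0 h; have nr := edge_norm_ge h.
    rewrite quat_normM quat_normX quat_normV//; apply: ler_pM => //;
      last exact: kM.
    by apply: lerXn2r; rewrite ?nnegrE ?invr_ge0 ?(ltW r0)// lef_pV2 ?posrE
      ?normr_gt0.
  move=> /(ler_wpM2l (exprn_ge0 n.+1 (normr_ge0 z))) h; apply: le_trans h _.
  by rewrite expr_div_n exprVn le_eqVlt; apply/orP; left; apply/eqP; ring.
rewrite -[X in _ --> X](mulr0 (m^-1 * (32 * M * r))).
apply: cvgM; first exact: cvg_cst.
apply: cvg_expr; rewrite ger0_norm ?divr_ge0 ?(ltW r0)//.
by rewrite ltr_pdivrMr// mul1r.
Qed.

End Taylor.

(** * Power series *)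

Section PowerSeries.
Variables (R : realType).
Local Notation H := (quaternion R).
Implicit Types (p q z w A : H) (b c : nat -> H) (r s t : R).

Lemma geometric_sum_le t n : 0 <= t < 1 ->
  \sum_(0 <= i < n) t ^+ i <= (1 - t)^-1.
Proof.
move=> /andP[t0 t1]; have t1' : 0 < 1 - t by rewrite subr_gt0.
have E : (1 - t) * \sum_(0 <= i < n) t ^+ i = 1 - t ^+ n.
  elim: n => [|n IH]; first by rewrite big_nil mulr0 expr0 subrr.
  by rewrite big_nat_recr//= mulrDr IH exprS; ring.
rewrite -[leRHS]mul1r ler_pdivlMr// mulrC E.
by have := exprn_ge0 n t0; lra.
Qed.

Lemma cvg_dist_le (V : normedModType R) (u : nat -> V) (l x : V) (M : R) :
  (forall n, `|u n - x| <= M) -> u @ \oo --> l -> `|l - x| <= M.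
Proof.
move=> uM ul; apply/ler_addgt0Pr => e e0.
have /cvgrPdist_le/(_ e e0)[N _ hN] := ul.
have := hN N (leqnn N) => /= h.
have -> : l - x = (l - u N) + (u N - x) by rewrite addrA subrK.
by apply: le_trans (ler_normD _ _) _; rewrite addrC; apply: lerD.
Qed.

Lemma quat_series_cvg b (C t : R) : 0 <= t < 1 ->
  (forall n, `|b n| <= C * t ^+ n) ->
  exists l : H, series b @ \oo --> l.
Proof.
move=> t01 bC.
have real (u : nat -> R) : (forall n, `|u n| <= `|b n|) ->
    exists l, series u @ \oo --> (l : R).
  move=> ub; exists (limn (series u)).
  have : cvgn [normed series u].
    apply: (@series_le_cvg _ _ (geometric C t)) => [n|n|n|] /=.
    - exact: normr_ge0.
    - by apply: le_trans (bC n); exact: normr_ge0.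
    - exact: le_trans (ub n) (bC n).
    - apply: is_cvg_geometric_series.
      by have /andP[t0 t1] := t01; rewrite ger0_norm.
  by move/normed_cvg.
have [l1 h1] := real (fun n => qre (b n)) (fun n => ler_qre (b n)).
have [l2 h2] := real (fun n => qi (b n)) (fun n => ler_qi (b n)).
have [l3 h3] := real (fun n => qj (b n)) (fun n => ler_qj (b n)).
have [l4 h4] := real (fun n => qk (b n)) (fun n => ler_qk (b n)).
exists (Quat l1 l2 l3 l4).
pose c n := `|series (fun n => qre (b n)) n - l1| + `|series (fun n => qi (b
  n)) n - l2|
 + `|series (fun n => qj (b n)) n - l3| + `|series (fun n => qk (b n)) n - l4|.
apply: (cvg_normr0 (c := c)) => [n|].
  apply: le_trans (quat_norm_le _) _; rewrite /c /series /=.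
  have sE (g : H -> R) : (forall x y, g (x + y) = g x + g y) -> g 0 = 0 ->
      g (\sum_(0 <= i < n.+1) b i) = \sum_(0 <= i < n.+1) g (b i).
    by move=> gD g0; apply: (big_morph g).
  by rewrite -!sE.
rewrite -[X in _ --> X](_ : 0 + 0 + 0 + 0 = 0); last by rewrite !addr0.
have z (u : nat -> R) (l : R) : u @ \oo --> l ->
  (fun n => `|u n - l|) @ \oo --> 0.
  move=> ul; rewrite -[X in _ --> X](normr0 R) -(subrr l).
  by apply: cvg_norm; apply: cvgB => //; exact: cvg_cst.
by do ! apply: cvgD; apply: z.
Qed.

(** The terms of a convergent series are bounded. The test point is real, hence on every line. *)
Lemma series_coeff_le b r : 0 < r ->
  cvgn (series (fun n => (r%:A) ^+ n * b n)) ->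
  exists2 M : R, 0 <= M & forall n, `|b n| <= M * r^-1 ^+ n.
Proof.
move=> r0 /cvg_series_cvg_0 h.
have [M0 [_ hM]] := cvg_seq_bounded (cvgP _ h).
exists `|M0 + 1| => // n; have := hM (M0 + 1).
rewrite ltrDl ltr01 => /(_ isT n I) /=.
rewrite quat_normM quat_normX normrZ quat_norm1 mulr1 (gtr0_norm r0).
move=> {}h; rewrite exprVn ler_pdivlMr ?exprn_gt0// mulrC.
exact: le_trans h (ler_norm _).
Qed.

End PowerSeries.

(** * Holomorphy of power series on a line *)

Section SeriesHol.
Variables (R : realType) (I : quaternion R).
Local Notation H := (quaternion R).
Hypothesis uI : imag_units I.
Local Notation L := (complex_line I).
Implicit Types (p q z w A : H) (b c : nat -> H) (r s t : R).

(** Trading the factor [n] for a slightly larger radius keeps the derived series under a geometric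
    one. At [n = 0] the factor [*+ n] cancels the meaningless exponent [n.-1]. *)
Lemma dpow_le z s e n : 0 < e -> `|z| <= s ->
  `|z ^+ n.-1 *+ n| <= e^-1 * (s + e) ^+ n.
Proof.
move=> e0 zs; have s0 : 0 <= s by exact: le_trans zs.
elim: n => [|n IH].
  by rewrite mulr0n normr0 expr0 mulr1 invr_ge0 ltW.
have -> : z ^+ n.+1.-1 *+ n.+1 = z * (z ^+ n.-1 *+ n) + z ^+ n.
  by rewrite mulrSr /= mulrnAr -exprS; case: n {IH}.
apply: le_trans (ler_normD _ _) _; rewrite quat_normM quat_normX.
have -> : e^-1 * (s + e) ^+ n.+1 = s * (e^-1 * (s + e) ^+ n) + (s + e) ^+ n.
  by rewrite exprS; field; rewrite gt_eqF.
apply: lerD; first by apply: ler_pM.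
by apply: lerXn2r; rewrite ?nnegrE ?addr_ge0 ?(ltW e0)//; lra.
Qed.

(** The remainder at [n.+1] is [w] times the one at [n] plus [(w - z)^2 * n * z^(n-1)]. By [dpow_le]
    the new term is at most [e] times the inductive bound, which therefore grows by the factor
    [s + e]. *)
Lemma pow_taylor_le z w s e n : L z -> L w -> 0 < e -> `|z| <= s -> `|w| <= s ->
  `|w ^+ n - z ^+ n - (w - z) * (z ^+ n.-1 *+ n)| <=
  `|w - z| ^+ 2 * e^-1 ^+ 2 * (s + e) ^+ n.
Proof.
move=> Lz Lw e0 zs ws; have s0 : 0 <= s by exact: le_trans zs.
elim: n => [|n IH].
  by rewrite !expr0 subrr mulr0n mulr0 subrr normr0 mulr1 mulr_ge0 ?sqr_ge0.
have -> : w ^+ n.+1 - z ^+ n.+1 - (w - z) * (z ^+ n.+1.-1 *+ n.+1) =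
    w * (w ^+ n - z ^+ n - (w - z) * (z ^+ n.-1 *+ n))
    + (w - z) * ((w - z) * (z ^+ n.-1 *+ n)).
  have -> : z ^+ n.+1.-1 *+ n.+1 = z * (z ^+ n.-1 *+ n) + z ^+ n.
    by rewrite mulrSr /= mulrnAr -exprS; case: n {IH}.
  rewrite !exprS; set d := _ *+ n; set u := w ^+ n; set v := z ^+ n.
  rewrite !(mulrBr, mulrBl, mulrDr, mulrA) (line_comm uI Lw Lz).
  by apply: quat_ext => /=; ring.
apply: le_trans (ler_normD _ _) _; rewrite !quat_normM.
have h1 := dpow_le n e0 zs.
have h2 := ler_pM (normr_ge0 w) (normr_ge0 _) ws IH.
have h3 : `|w - z| * (`|w - z| * `|z ^+ n.-1 *+ n|) <=
    `|w - z| * (`|w - z| * (e^-1 * (s + e) ^+ n)).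
  by do 2 apply: ler_wpM2l => //.
apply: le_trans (lerD h2 h3) _; rewrite le_eqVlt; apply/orP; left; apply/eqP.
by rewrite (exprS _ n); field; rewrite gt_eqF.
Qed.

Theorem series_hol b r (f : H -> H) :
  (forall z, L z -> `|z| < r -> series (fun n => z ^+ n * b n) @ \oo --> f z) ->
  forall z, L z -> `|z| < r -> hol I f z.
Proof.
move=> hf z Lz zr.
(* The gap up to [r] is cut in four: [w] stays within [s = |z| + e], monomials are bounded at radius
   [s + e], coefficients at [rho = |z| + 3 * e < r], and the ratio [t] of the last two radii is
   below 1. *)
pose e := (r - `|z|) / 4; have e0 : 0 < e by rewrite divr_gt0// subr_gt0.
pose s := `|z| + e; pose rho := `|z| + 3 * e.
have z0 := normr_ge0 z.
have rho0 : 0 < rho by rewrite /rho; lra.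
have rhor : rho < r by rewrite /rho /e; lra.
have [M M0 bM] : exists2 M : R, 0 <= M & forall n, `|b n| <= M * rho^-1 ^+ n.
  apply: series_coeff_le => //; apply: cvgP; apply: hf; first exact: line_real.
  by rewrite normrZ quat_norm1 mulr1 gtr0_norm.
pose t := (s + e) / rho.
have t01 : 0 <= t < 1.
  by rewrite divr_ge0 ?(ltW rho0) ?ltr_pdivrMr//= ?mul1r /s /rho; lra.
have se0 : 0 <= s + e by rewrite /s; lra.
have zs : `|z| <= s by rewrite /s; lra.
have ebt n (x y : H) (K : R) : `|x| <= K * (s + e) ^+ n ->
  `|x * b n| <= K * M * t ^+ n.
  move=> xK; rewrite quat_normM.
  have -> : K * M * t ^+ n = K * (s + e) ^+ n * (M * rho^-1 ^+ n).
    by rewrite /t expr_div_n exprVn; ring.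
  exact: ler_pM.
have [A hA] : exists A : H, series (fun n => (z ^+ n.-1 *+ n) * b n) @ \oo -->
  A.
  apply: (quat_series_cvg (C := e^-1 * M) t01) => n.
  by apply: ebt => //; exact: dpow_le.
have [t0 t1] := andP t01.
pose K := e^-1 ^+ 2 * M / (1 - t).
have K0 : 0 <= K.
  by apply: divr_ge0; [apply: mulr_ge0 => //;
    exact: sqr_ge0|rewrite subr_ge0 ltW].
have quad w : L w -> `|w - z| < e ->
  `|f w - f z - (w - z) * A| <= `|w - z| ^+ 2 * K.
  move=> Lw wz; have ws : `|w| <= s.
    rewrite -[w](subrK z) addrC; apply: le_trans (ler_normD _ _) _.
    by rewrite lerD2l ltW.
  have wr : `|w| < r by apply: le_lt_trans ws _; rewrite /s /e; lra.
  rewrite -[X in `|X|]subr0.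
  pose S n := series (fun n => w ^+ n * b n) n - series (fun n => z ^+ n * b n)
    n
    - (w - z) * series (fun n => (z ^+ n.-1 *+ n) * b n) n.
  apply: (@cvg_dist_le _ _ S) => [n|].
    rewrite subr0 /S /series /= big_distrr -!sumrB /=.
    apply: le_trans (ler_norm_sum _ _ _) _.
    have -> : `|w - z| ^+ 2 * K = `|w - z| ^+ 2 * (e^-1 ^+ 2) * M * (1 - t)^-1.
      by rewrite /K; ring.
    apply: le_trans (_ : \sum_(0 <= i < n) `|w - z| ^+ 2 * e^-1 ^+ 2 * M * t ^+
      i <= _).
      apply: ler_sum => i _; rewrite -mulrBl mulrA -mulrBl.
      by apply: ebt => //; exact: pow_taylor_le.
    rewrite -big_distrr /=; apply: ler_wpM2l; last exact: geometric_sum_le.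
    by rewrite mulr_ge0// mulr_ge0// sqr_ge0.
  apply: cvgB; first by apply: cvgB; exact: hf.
  apply/cvgrPdist_lt => x x0.
  have k1 : 0 < `|w - z| + 1 by rewrite ltr_wpDl.
  have /cvgrPdist_lt/(_ _ (divr_gt0 x0 k1)) := hA.
  apply: filterS => n hn; rewrite -mulrBr quat_normM.
  rewrite ltr_pdivlMr// in hn; apply: le_lt_trans hn;
    rewrite mulrC ler_wpM2l//; lra.
exists A => x x0; exists (Num.min e (x / (K + 1))).
  by rewrite lt_min e0 divr_gt0// ltr_wpDl.
move=> w Lw; rewrite lt_min => /andP[we wx].
apply: le_trans (quad w Lw we) _; rewrite expr2 -mulrA mulrC ler_wpM2r//.
move: wx; rewrite ltr_pdivlMr ?ltr_wpDl// => wx.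
by apply: le_trans (ltW wx); rewrite ler_wpM2l//; lra.
Qed.

End SeriesHol.

(** * Coefficients are determined by the real axis *)

Section Uniqueness.
Variable R : realType.
Local Notation H := (quaternion R).
Implicit Types (b c : nat -> H) (r x : R).

(** The value at 0 gives [c 0], and division by [x] gives the shifted series for [x] nonzero. At 0
    the shifted series has sum [c 1], which vanishes by letting [x] tend to 0 in a bound on its
    tail. *)
Lemma real_series_shift c r : 0 < r ->
  (forall x, `|x| < r -> series (fun n => x%:A ^+ n * c n) @ \oo --> (0 : H)) ->
  c 0%N = 0 /\
  (forall x, `|x| < r -> series (fun n => x%:A ^+ n * c n.+1) @ \oo -->
    (0 : H)).
Proof.
move=> r0 hc.
have at0 b n : series (fun n => (0 : R)%:A ^+ n * b n) n.+1 = b 0%N.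
  rewrite /series /= big_nat_recl//= expr0 mul1r big1 ?addr0// => i _.
  by rewrite scale0r expr0n mul0r.
have c0 : c 0%N = 0.
  have h : series (fun n => (0 : R)%:A ^+ n * c n) @ \oo --> c 0%N.
    apply: (cvg_normr0 (c := fun=> 0)) => [n|]; last exact: cvg_cst.
    by rewrite at0 subrr normr0.
  have h0 : `|0 : R| < r by rewrite normr0.
  exact: (cvg_unique (@norm_hausdorff _ _) h (hc 0 h0)).
split=> //.
have ne0 x : x != 0 -> `|x| < r ->
  series (fun n => x%:A ^+ n * c n.+1) @ \oo --> (0 : H).
  move=> x0 xr; have h := hc x xr; rewrite -[X in _ --> X](scaler0 _ x^-1).
  have -> : series (fun n => x%:A ^+ n * c n.+1) =
      (fun n => x^-1 *: series (fun n => x%:A ^+ n * c n) n.+1).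
    apply/funext => n; rewrite /series /= big_nat_recl//= c0 mulr0 add0r
      scaler_sumr.
    apply: eq_bigr => i _; rewrite exprS -scalerAl mul1r -scalerAl scalerA
      mulVf//.
    by rewrite scale1r.
  apply: cvgZr; have := h; by rewrite -(@cvg_shiftS _ (series _)).
have [M M0 cM] : exists2 M : R, 0 <= M & forall n,
  `|c n| <= M * (r / 2)^-1 ^+ n.
  apply: series_coeff_le; first by rewrite divr_gt0.
  by apply/cvgP/hc; rewrite ger0_norm ?divr_ge0 ?(ltW r0)//; lra.
(* Coefficients are measured at [r / 2]; for [x < r / 4] the tail is geometric of ratio below 1/2,
   whose sum is at most 2. *)
pose K := 2 * M * (r / 2)^-1 ^+ 2.
have K0 : 0 <= K by rewrite !mulr_ge0 ?invr_ge0// divr_ge0 ?(ltW r0).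
have c1x x : 0 < x -> x < r / 4 -> `|c 1%N| <= x * K.
  move=> x0 xr; rewrite -normrN -sub0r.
  have h : series (fun n => x%:A ^+ n * c n.+1) @ \oo --> (0 : H).
    by apply: ne0; [rewrite gt_eqF|rewrite gtr0_norm//; lra].
  have : (fun n => series (fun n => x%:A ^+ n * c n.+1) n.+1) @ \oo --> (0 : H).
    by rewrite cvg_shiftS.
  apply: cvg_dist_le => n.
  rewrite /series /= big_nat_recl//= expr0 mul1r addrAC subrr add0r.
  apply: le_trans (ler_norm_sum _ _ _) _.
  apply: le_trans (_ : \sum_(0 <= i < n) x * (M * (r / 2)^-1 ^+ 2) * (x / (r /
    2)) ^+ i <= _).
    apply: ler_sum => i _; rewrite quat_normM quat_normX normrZ quat_norm1
      mulr1.
    rewrite gtr0_norm//; apply: le_trans (ler_wpM2l _ (cM _)) _.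
      by rewrite exprn_ge0// ltW.
    rewrite le_eqVlt; apply/orP; left; apply/eqP.
    set y := (r / 2)^-1; rewrite -[x / _]/(x * y) exprMn (exprS x) (exprS y
      i.+1) (exprS y i).
    by move: (x ^+ i) (y ^+ i) => *; ring.
  rewrite -big_distrr /= /K.
  have tt : 0 <= x / (r / 2) < 1.
    rewrite divr_ge0 ?(ltW x0) ?divr_ge0 ?(ltW r0)//= ltr_pdivrMr ?mul1r
      ?divr_gt0//; lra.
  have -> : x * (2 * M * (r / 2)^-1 ^+ 2) = x * (M * (r / 2)^-1 ^+ 2) * 2 by
    ring.
  apply: ler_wpM2l.
    by rewrite !mulr_ge0 ?invr_ge0 ?(ltW x0)// divr_ge0 ?(ltW r0).
  apply: le_trans (geometric_sum_le n tt) _.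
  rewrite invf_ple ?posrE//; last by rewrite subr_gt0; case/andP: tt.
  rewrite lerBrDr -lerBrDl ler_pdivrMr ?divr_gt0//; lra.
have c1 : c 1%N = 0.
  apply/eqP; rewrite -normr_eq0 eq_le normr_ge0 andbT.
  apply/ler_addgt0Pl => e e0; rewrite addr0.
  pose x := Num.min (r / 8) (e / (K + 1)).
  have K1 : 0 < K + 1 by rewrite ltr_wpDl.
  have x0 : 0 < x by rewrite lt_min !divr_gt0.
  have xr : x <= r / 8 by rewrite ge_min lexx.
  have xe : x <= e / (K + 1) by rewrite ge_min lexx orbT.
  apply: le_trans (c1x _ x0 _) _; first by lra.
  rewrite ler_pdivlMr// in xe; apply: le_trans xe.
  by rewrite ler_wpM2l ?(ltW x0)//; lra.
move=> x xr; have [->|x0] := eqVneq x 0; last exact: ne0.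
apply: (cvg_normr0 (c := fun=> 0)) => [n|]; last exact: cvg_cst.
by rewrite (at0 (fun n => c n.+1)) c1 subrr normr0.
Qed.

Lemma real_series_eq0 c r : 0 < r ->
  (forall x, `|x| < r -> series (fun n => x%:A ^+ n * c n) @ \oo --> (0 : H)) ->
  forall n, c n = 0.
Proof.
move=> r0 hc n; elim: n c hc => [|n IH] c hc;
  first by have [] := real_series_shift r0 hc.
by apply: (IH (fun n => c n.+1)); have [] := real_series_shift r0 hc.
Qed.

End Uniqueness.

(** * Slice regularity and sigma-analyticity *)

(** Translates ['d] into the epsilon form of [slice_deriv]; each direction of the final theorem uses
    one implication. *)
Lemma diff_epsP (R : realType) (V W : normedModType R) (g : V -> W) x
    (df : {linear V -> W}) : continuous df ->
  (differentiable g x /\ 'd g x = df :> (V -> W)) <->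
  (forall e : R, 0 < e -> exists2 d : R, 0 < d & forall h, `|h| < d ->
    `|g (h + x) - g x - df h| <= e * `|h|).
Proof.
move=> cdf; split=> [[dg dE] e e0|H].
  have := diff_locally dg; rewrite dE => /eqaddoP/(_ _ e0)/nbhs_normP[d /= d0
    hd].
  exists d => // h hd0; have := hd h;
    rewrite /ball_ /= sub0r normrN => /(_ hd0).
  by rewrite opprD addrA.
have o : g \o shift x = cst (g x) + df +o_ 0 id.
  apply/eqaddoP => e e0; have [d d0 hd] := H e e0.
  apply/nbhs_normP; exists d => // h; rewrite /ball_ /= sub0r normrN => /hd.
  by rewrite opprD addrA.
by have dE := diff_unique cdf o; split=> //; apply/diff_locallyP; rewrite dE.
Qed.

(** * Slice holomorphy and complex differentiability on a line *)

Section Differentiability.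
Variables (R : realType) (I : quaternion R).
Local Notation H := (quaternion R).
Hypothesis uI : imag_units I.
Implicit Types (f : H -> H) (A : H) (z h : R * R).

(** The Cauchy-Riemann equation reads [D (0, 1) = I * D (1, 0)], so the real differential is the
    increment on the line times [D (1, 0)]. *)
Lemma slice_holomorphic_hol (Omega : set H) f z : slice_holomorphic Omega I f ->
  Omega (slice_pt I z) -> hol I f (slice_pt I z).
Proof.
move=> hf Oz; have [df CR] := hf z Oz.
have := CR; rewrite !deriveE// => {CR}.
set D := 'd _ z => CR.
have DE h : D h = slice_pt I h * D (1, 0).
  have e0 : D (1, 0) + I * D (0, 1) = 0.
    by apply: (scalerI (_ : 2^-1 != 0 :> R)); rewrite ?scaler0// invr_neq0.
  have e1 : D (0, 1) = I * D (1, 0).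
    apply/eqP; rewrite -subr_eq0 -oppr_eq0 opprB; apply/eqP.
    by rewrite -[RHS](mulr0 I) -e0 mulrDr mulrA -expr2 [I ^+ 2]uI mulN1r.
  have -> : h = h.1 *: (1, 0) + h.2 *: (0, 1).
    by case: h => x y; congr pair; rewrite /= /GRing.scale /= !(mulr0, mulr1,
      addr0, add0r).
  rewrite linearD !linearZ e1 /slice_pt mulrDl -!scalerAl mul1r /=.
  by congr (_ *: _ + _ *: _); rewrite /GRing.scale /= !(mulr0, mulr1, addr0,
    add0r).
exists (D (1, 0)) => e e0.
have [d d0 hd] := (diff_epsP (f \o slice_pt I) z (diff_continuous df)).1
  (conj df erefl) e e0.
exists d => // _ [w _ <-]; rewrite -slice_ptB => wd.
have wn : `|w - z| <= `|slice_pt I (w - z)|.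
  by rewrite prod_normE ge_max ge_slice_pt1// ge_slice_pt2.
have := hd (w - z) (le_lt_trans wn wd); rewrite subrK [X in _ - X]DE => h.
by apply: le_trans h _; rewrite ler_wpM2l// ltW.
Qed.

Definition slice_lin A h : H := slice_pt I h * A.

Let slice_lin_linear A : linear (slice_lin A).
Proof.
by move=> k u v; rewrite /slice_lin slice_ptD mulrDl scalerAl;
  congr (_ * _ + _);
  rewrite /slice_pt scalerDr !scalerA /= .
Qed.

HB.instance Definition _ A :=
  GRing.isLinear.Build R (R * R)%type H *:%R (slice_lin A) (slice_lin_linear A).

Lemma hol_slice_diff f z : hol I f (slice_pt I z) ->
  differentiable (f \o slice_pt I) z /\
  2^-1 *: ('D_(1, 0) (f \o slice_pt I) z + I * 'D_(0,
    1) (f \o slice_pt I) z) = 0.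
Proof.
move=> [A fA].
(* [R * R] carries the maximum norm; the factor 2 explains the halving of [e] and [d] below. *)
have sn h : `|slice_pt I h| <= 2 * `|h|.
  apply: le_trans (norm_slice_pt_le uI h) _; rewrite mulrDl mul1r prod_normE.
  by apply: lerD; rewrite le_max lexx ?orbT.
have cA : continuous (slice_lin A).
  have -> : slice_lin A = (fun h => h.1 *: A + h.2 *: (I * A)) :> (R * R -> H).
    by apply/funext => h; rewrite /slice_lin /slice_pt mulrDl -!scalerAl mul1r.
  by move=> z0; apply: cvgD; apply: cvgZl; [exact: cvg_fst|exact: cvg_snd].
have [df dE] : differentiable (f \o slice_pt I) z /\
    'd (f \o slice_pt I) z = slice_lin A :> (R * R -> H).
  apply/(diff_epsP _ _ cA) => e e0; have e2 : 0 < e / 2 by rewrite divr_gt0.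
  have [d d0 hd] := fA _ e2; exists (d / 2); first by rewrite divr_gt0.
  move=> w wd; have sw := sn w; rewrite /= /slice_lin.
  have wE : slice_pt I (w + z) - slice_pt I z = slice_pt I w.
    by rewrite -slice_ptB addrK.
  have := hd (slice_pt I (w + z)) (line_pt _ _); rewrite wE => h.
  apply: le_trans (h _) _; first by lra.
  by apply: le_trans (ler_wpM2l (ltW e2) sw) _; rewrite mulrA mulfVK.
split=> //; rewrite !deriveE// dE /slice_lin /slice_pt /= !(scale1r, scale0r,
  addr0, add0r).
by rewrite mul1r mulrA -expr2 [I ^+ 2]uI mulN1r subrr scaler0.
Qed.

End Differentiability.

(** * Regular powers, sigma-balls and local expansions *)

Section RegularPower.
Variable R : realType.
Local Notation H := (quaternion R).
Implicit Types (p q I : H).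

(** The coefficients of the power of ['X - p%:P] commute with [q], so left and right evaluation
    agree, and evaluation is multiplicative. *)
Lemma regular_powE p q n : GRing.comm p q -> regular_pow p n q = (q - p) ^+ n.
Proof.
move=> pq; have cX : comm_poly ('X - p%:P) q.
  by rewrite /comm_poly !hornerE mulrBl mulrBr pq.
have coefc m i : GRing.comm (('X - p%:P) ^+ m)`_i q.
  elim: m i => [|m IH] i; first by rewrite expr0 coef1;
    exact/commr_sym/commr_nat.
  rewrite exprSr mulrBr coefB coefMX coefMC; apply/commr_sym/commrB.
    by case: ifP => _; apply/commr_sym; [exact/commr_sym/commr0|exact: IH].
  by apply: commrM; [exact/commr_sym/IH|exact/commr_sym].
rewrite /regular_pow /right_horner.
transitivity (('X - p%:P) ^+ n).[q].
  rewrite horner_coef; apply: eq_bigr => i _.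
  by apply/commr_sym/commrX/coefc.
by rewrite horner_exp_comm// !hornerE.
Qed.

Lemma sigma_distC p q : sigma_dist p q = sigma_dist q p.
Proof.
rewrite /sigma_dist (_ : same_line p q = same_line q p).
  by rewrite distrC omega_distC.
by apply/propext; split; exact: same_lineC.
Qed.

(** Off the lines through [p], sigma is [omega_dist], which is at least [|qim p|]. *)
Lemma sigma_ball_same_line p q r : qim p != 0 -> r <= `|qim p| ->
  sigma_dist q p < r -> same_line q p.
Proof.
move=> p0 rp; rewrite /sigma_dist; case: ifPn => [/asboolP//|_].
rewrite ltNge => /negP[]; apply: le_trans rp _.
rewrite /omega_dist -[leLHS]ger0_norm// -sqrtr_sqr ler_wsqrtr//.
apply: (@le_trans _ _ ((`|qim q| + `|qim p|) ^+ 2));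
  last by rewrite lerDr sqr_ge0.
by rewrite lerXn2r// ?nnegrE ?addr_ge0// lerDr.
Qed.

Lemma hol_translate I f p q : complex_line I p -> hol I f (p + q) ->
  imag_units I -> hol I (fun w => f (p + w)) q.
Proof.
move=> Lp [A fA] uI; exists A => e e0; have [d d0 hd] := fA e e0.
exists d => // w Lw wq; have E : (p + w) - (p + q) = w - q.
  by rewrite opprD addrACA subrr add0r.
by have := hd (p + w) (lineD uI Lp Lw); rewrite E; apply.
Qed.

(** The expansion needs the closed square of half-side [r], whose points are within [2 * r] of the
    centre; hence the margin [3 * r]. *)
Lemma slice_regular_series (Omega : set H) f I p (r : R) : imag_units I ->
  complex_line I p -> slice_holomorphic Omega I f -> 0 < r ->
  (forall q, `|q - p| < 3 * r -> Omega q) ->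
  exists b : nat -> H, forall q, complex_line I q -> `|q - p| < r ->
    series (fun n => (q - p) ^+ n * b n) @ \oo --> f q.
Proof.
move=> uI Lp hf r0 Or.
have [b hb] : exists b : nat -> H, forall z, complex_line I z -> `|z| < r ->
    series (fun n => z ^+ n * b n) @ \oo --> f (p + z).
  apply: (hol_series uI (g := fun w => f (p + w)) r0) => x y xy.
  apply: hol_translate => //.
  have [u _ uE] := lineD uI Lp (line_pt I (x, y)).
  have := xy; rewrite /in_rect -!ler_norml => /andP[xr yr].
  have pr : `|slice_pt I (x, y)| < 3 * r.
    by apply: le_lt_trans (norm_slice_pt_le uI _) _ => /=; lra.
  rewrite -uE; apply: slice_holomorphic_hol hf _ => //.
  by apply: Or; rewrite uE addrC addKr.
exists b => q Lq qr; have := hb (q - p) (lineB uI Lq Lp) qr.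
by rewrite [p + _]addrC subrK.
Qed.

End RegularPower.

Theorem theorem1p10 (R : realType) (Omega : set (quaternion R))
    (f : quaternion R -> quaternion R) :
  quat_domain Omega ->
  (slice_regular Omega f <-> sigma_analytic Omega f).
Proof.
move=> [_ _ oO]; split=> [sr p Op|an I uI fI z Oz]; last first.
  apply: (hol_slice_diff uI); set p := slice_pt I z in Oz *.
  have Lp : complex_line I p by exact: line_pt.
  have [U [b [_ pU Ub]]] := an p Oz.
  have [r /= r0 rU] := (@nbhs_ballP _ (sigma_quaternion R) _ _).1 pU.
  (* The points [p + w] share the line of [p]: there sigma is the Euclidean distance and regular
     powers are ordinary powers of [w]. *)
  have h0 : hol I (fun w => f (p + w)) 0.
    apply: (series_hol uI (b := b) (r := r)) => [w Lw wr| |]; last 2 first.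
    - exact: line0.
    - by rewrite normr0.
    have Lpw := lineD uI Lp Lw.
    have : U (p + w).
      apply: rU; change (is_true (sigma_dist p (p + w) < r)).
      rewrite /sigma_dist asboolT; last by exists I.
      by rewrite opprD addrA subrr sub0r normrN.
    move=> /Ub; rewrite (_ : (fun n => regular_pow p n (p + w) * b n) =
      (fun n => w ^+ n * b n))//; apply/funext => n.
    by rewrite regular_powE ?[p + w]addrC ?addrK//;
      apply: (line_comm uI) => //; rewrite addrC.
  have := @hol_translate _ I (fun w => f (p + w)) (- p) p (lineN uI Lp).
  rewrite addNr => /(_ h0 uI); congr (hol I _ p); apply/funext => w.
  by rewrite addrA subrr add0r.
have [r0 /= r00 hr0] := (@nbhs_ballP _ (quaternion R) _ _).1 (open_nbhs_nbhs
  (conj oO Op)).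
pose r := r0 / 3; have rp : 0 < r by rewrite divr_gt0.
have Or q : `|q - p| < 3 * r -> Omega q.
  move=> qp; apply: hr0; rewrite -ball_normE /ball_ /= distrC.
  by have -> : r0 = 3 * r by rewrite /r; field.
have [I uI Lp] := exists_line p.
have [b hb] := slice_regular_series uI Lp (sr I uI) rp Or.
(* For nonreal [p] this radius confines the sigma-ball to the line of [p]; for real [p] every point
   shares a line with [p]. *)
pose s := if qim p == 0 then r else Num.min r `|qim p|.
have s0 : 0 < s by rewrite /s; case: eqVneq => // p0;
  rewrite lt_min rp normr_gt0.
have sr' : s <= r by rewrite /s; case: ifP => // _; rewrite ge_min lexx.
exists [set q | sigma_dist q p < s], b; split.
- move=> q /= qs; apply: Or; apply: le_lt_trans (norm_le_sigma _ _) _; lra.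
- apply/(@nbhs_ballP _ (sigma_quaternion R)); exists s => //= q.
  move=> pq; change (is_true (sigma_dist p q < s)) in pq.
  by change (is_true (sigma_dist q p < s)); rewrite sigma_distC.
move=> q /= qs; have qr : `|q - p| < r.
  by apply: le_lt_trans (norm_le_sigma _ _) _; lra.
(* It is enough that [p] and [q] lie on some line on which the coefficients [b], found on the line
   [I], still expand [f]. *)
have [J [uJ Jp Jq hJ]] : exists J, [/\ imag_units J, complex_line J p,
  complex_line J q &
    forall w, complex_line J w -> `|w - p| < r ->
    series (fun n => (w - p) ^+ n * b n) @ \oo --> f w].
  have [p0|p0] := eqVneq (qim p) 0; last first.
    have [J [uJ Jq Jp]] : same_line q p.
      by apply: (sigma_ball_same_line p0 _ qs);
        rewrite /s (negbTE p0) ge_min lexx orbT.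
    exists I; split => //.
    have [/eqP|lJI] := complex_lineE uI Lp; first by rewrite (negbTE p0).
    exact: lJI Jq.
  have preal : p = (qre p)%:A by rewrite {1}[p]quat_re_im p0 addr0.
  have [J uJ Jq] := exists_line q.
  have Jp : complex_line J p by rewrite preal; exact: line_real.
  have [c hc] := slice_regular_series uJ Jp (sr J uJ) rp Or.
  exists J; split => // w Jw wr.
  (* Both expansions represent [f] on the real axis, which belongs to both lines. *)
  suff -> : b = c by exact: hc.
  apply/funext => n; apply/eqP; rewrite -subr_eq0; apply/eqP.
  apply: (real_series_eq0 (c := fun n => b n - c n) rp) => x xr.
  have xE : p + x%:A - p = x%:A by rewrite addrC addKr.
  have xn : `|p + x%:A - p| < r by rewrite xE normrZ quat_norm1 mulr1.
  have h1 := hb (p + x%:A) (lineD uI Lp (line_real _ _)) xn.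
  have h2 := hc (p + x%:A) (lineD uJ Jp (line_real _ _)) xn.
  rewrite xE in h1 h2; rewrite -[X in _ --> X](subrr (f (p + x%:A))).
  rewrite (_ : series _ = series (fun n => x%:A ^+ n * b n)
    - series (fun n => x%:A ^+ n * c n)); first exact: cvgB h1 h2.
  apply/funext => m; rewrite /series /= fctE -sumrB.
  by apply: eq_bigr => i _; rewrite mulrBr.
rewrite (_ : (fun n => regular_pow p n q * b n) = (fun n => (q - p) ^+ n * b
  n)).
  exact: hJ.
by apply/funext => n; rewrite regular_powE//; exact: (line_comm uJ).
Qed.
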